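(* Let $\mathbb D=\{z\in\mathbb C:|z|<1\}$, and let $\lambda:\partial\mathbb D\to\mathbb C$ with $|\lambda(\zeta)|=1$ for all $\zeta$, and $\varphi:\partial\mathbb D\to\mathbb R$ be Lebesgue measurable functions. Let $S$ be the set of all analytic functions $f:\mathbb D\to\mathbb C$ such that for almost every $\zeta\in\partial\mathbb D$, $\mathrm{Re}\,\{\overline{\lambda(\zeta)}\cdot f(z)\}\to\varphi(\zeta)$ as $z\to\zeta$ along any nontangential path in $\mathbb D$ ending at $\zeta$. Then $S$ has infinite dimension, i.e. the real linear span of the differences $f_1-f_2$, $f_1,f_2\in S$, is infinite-dimensional.
   Context: A nontangential path in $\mathbb D$ ending at $\zeta\in\partial\mathbb D$ is a path in $\mathbb D$ tending to $\zeta$ and lying, near $\zeta$, in some Stolz angle $\{z\in\mathbb D: |\arg(1-\bar\zeta z)|<\theta\}$ with $\theta<\pi/2$. The set $S$ is a real affine space; its dimension is that of the real linear space spanned by differences of its elements. *)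

(* Defs.v *)
From HB Require Import structures.
From mathcomp Require Import all_boot all_order all_algebra.
From mathcomp Require Import all_classical all_reals all_analysis.
From mathcomp Require Export complex.
Import Order.TTheory GRing.Theory Num.Theory.
Import numFieldTopology.Exports numFieldNormedType.Exports.
Set Implicit Arguments.
Unset Strict Implicit.
Unset Printing Implicit Defensive.
Local Open Scope ring_scope.
Local Open Scope classical_set_scope.

HB.instance Definition _ (R : rcfType) := PseudoPointedMetric.copy R[i] R[i]^o.
HB.instance Definition _ (R : rcfType) := NormedModule.copy R[i] R[i]^o.

Section Defs.
Variable R : realType.
Local Notation C := R[i].

Definition disc : set C := [set z | `|z| < 1].

Definition expi (t : R) : C := Complex (cos t) (sin t).

(* principal argument Arg w in (-pi, pi] (Arg 0 := 0) *)
Definition Arg (w : C) : R :=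
  let a := complex.Re w in let b := complex.Im w in
  if 0 < a then atan (b / a)
  else if a < 0 then (if 0 <= b then atan (b / a) + pi else atan (b / a) - pi)
  else if 0 < b then pi / 2 else if b < 0 then - (pi / 2) else 0.

Definition stolz (zeta : C) (theta : R) : set C :=
  [set z | `|z| < 1 /\ `|Arg (1 - conjc zeta * z)| < theta].

Definition nontangential_path (zeta : C) (gamma : R -> C) : Prop :=
  (forall t, 0 <= t < 1 -> disc (gamma t)) /\
  {within `[0, 1[, continuous gamma} /\
  gamma @ (1 : R)^'- --> zeta /\
  exists theta : R, theta < pi / 2 /\
    \forall t \near (1 : R)^'-, stolz zeta theta (gamma t).

Definition analytic_on_disc (f : C -> C) : Prop :=
  forall z, disc z -> @derivable C C C f z 1.

(* Lebesgue measurability of a real function of a real variable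
   (w.r.t. the completed Lebesgue sigma-algebra) *)
Definition Lmeasurable_fun (g : R -> R) : Prop :=
  @measurable_fun _ _
    (caratheodory_type (R:=R)
       (T:=lebesgue_stieltjes_measure_ocitv_type__canonical__measurable_structure_SemiRingOfSets R)
       (wlength idfun)^*%mu) R setT g.

Definition S_set (lam : C -> C) (phi : C -> R) : set (C -> C) :=
  [set f | analytic_on_disc f /\
     {ae (@completed_lebesgue_measure R), forall t : R,
        forall gamma, nontangential_path (expi t) gamma ->
          (fun s : R => complex.Re (conjc (lam (expi t)) * f (gamma s)))
            @ (1 : R)^'- --> phi (expi t)}].

Definition eq_on_disc (f g : C -> C) : Prop := forall z, disc z -> f z = g z.

Definition in_diff_span (S : set (C -> C)) (h : C -> C) : Prop :=
  exists (n : nat) (c : 'I_n -> R) (f g : 'I_n -> C -> C),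
    (forall i, S (f i) /\ S (g i)) /\
    eq_on_disc h (fun z => \sum_(i < n) ((c i)%:C)%C * (f i z - g i z)).

Definition infinite_dim_diff_span (S : set (C -> C)) : Prop :=
  forall n : nat, exists h : 'I_n -> C -> C,
    (forall i, in_diff_span S (h i)) /\
    (forall c : 'I_n -> R,
       eq_on_disc (fun z => \sum_(i < n) ((c i)%:C)%C * h i z) (fun _ => 0) ->
       forall i, c i = 0).

End Defs.

(* Main.v *)
(* On the unit circle g(w) = -2w/(1-w) satisfies Re g = 1 away from w = 1.  Given
   a measurable F = lambda * phi, pick a Laurent polynomial T close to F off a
   small set; for N large B(z) = T(z) g(z^N) is holomorphic in the disc, vanishes
   at 0 and is small on compact sets, while Re (conj lambda * B) is close to phi
   off a small set, because g(zeta^N) is bounded off a small set uniformly in N.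
   Iterating on the residual data gives a series sum_k B_k.  At almost every
   boundary point zeta, Borel-Cantelli bounds T_k(zeta) g(zeta^N_k) by a
   geometric sequence, and this bound extends to every nontangential approach
   region, so the sum f has a nontangential limit L with
   Re (conj lambda * L) = phi.  Solving with the data lambda * conj zeta^m gives
   solutions z^m (1 + O(z)) for every m, whose differences span an infinite
   dimensional space. *)
Require Import Defs.
From HB Require Import structures.
From mathcomp Require Import all_boot all_order all_algebra.
From mathcomp Require Import all_classical all_reals all_analysis.
From mathcomp Require Import measurable_realfun.
From mathcomp Require Import complex.
From mathcomp Require Import ring lra.
Import Order.TTheory GRing.Theory Num.Theory.
Import numFieldTopology.Exports numFieldNormedType.Exports.
Import ComplexField.Normc.
Local Open Scope ring_scope.
Local Open Scope classical_set_scope.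

Set Implicit Arguments.
Unset Strict Implicit.
Unset Printing Implicit Defensive.

(** * The complex modulus and the unit circle *)

(** The obstacle is that [g] is unbounded, so multiplying an approximation error by [g(zeta^N)] may
    destroy any gain. The remedy lies in the order of the choices. The set where
    [|1 - zeta^N| < gap k] has small measure whatever [N] is, so the loss [2 / gap k] of stage [k]
    is known before [T] and [N] are chosen, and the tolerance imposed on [T] can absorb it in
    advance. The exponent is made large last, for two purposes that depend on [T]: smallness inside
    the disc, and the transfer of the bound on [T(zeta) g(zeta^N)] from the boundary point to the
    cones at that point. Since [Re g = 1], the residual after a stage is the real part of
    [conj Lam * (Lam * r - T) * g]. It is therefore governed by the approximation error and not by
    the size of the data, which is why approximation in measure suffices for unbounded [phi] and why
    every stage after the first good one works with small data. *)

Section Modulus.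
Variable R : realType.
Local Notation C := R[i].
Implicit Types (z w : C).

Lemma norm_normc z : `|z| = (normc z)%:C%C. Proof. by case: z. Qed.

Lemma ler_normcD z w : normc (z + w) <= normc z + normc w.
Proof. exact: le_normcD. Qed.

Lemma normc_opp z : normc (- z) = normc z.
Proof. exact: (@complex.normcN R z). Qed.

Lemma normc_ge0 z : 0 <= normc z.
Proof. by case: z => a b; rewrite /normc sqrtr_ge0. Qed.

Lemma normcB z w : normc (z - w) = normc (w - z).
Proof. by rewrite -normc_opp opprB. Qed.

Lemma normcX z n : normc (z ^+ n) = normc z ^+ n.
Proof.
elim: n => [|n IH]; first by rewrite !expr0 normc1.
by rewrite !exprS normcM IH.
Qed.

Lemma normc_real (x : R) : normc (x%:C)%C = `|x|.
Proof. by rewrite /normc /= expr0n addr0 sqrtr_sqr. Qed.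

Lemma normc_sqr z : normc z ^+ 2 = complex.Re z ^+ 2 + complex.Im z ^+ 2.
Proof. by case: z => a b; rewrite /normc sqr_sqrtr //= addr_ge0 ?sqr_ge0. Qed.

Lemma Re_le_normc z : `|complex.Re z| <= normc z.
Proof.
by case: z => a b; rewrite /normc /= -sqrtr_sqr ler_wsqrtr // lerDl sqr_ge0.
Qed.

Lemma Im_le_normc z : `|complex.Im z| <= normc z.
Proof.
by case: z => a b; rewrite /normc /= -sqrtr_sqr ler_wsqrtr // lerDr sqr_ge0.
Qed.

Lemma normc_le_ReIm z : normc z <= `|complex.Re z| + `|complex.Im z|.
Proof.
case: z => a b /=.
rewrite -(ger0_norm (addr_ge0 (normr_ge0 a) (normr_ge0 b))) -sqrtr_sqr.
rewrite ler_wsqrtr // sqrrD !real_normK ?num_real // addrAC lerDl.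
by rewrite mulrn_wge0 // mulr_ge0.
Qed.

Lemma normc_conj z : normc (conjc z) = normc z.
Proof. by case: z => a b; rewrite /normc /= sqrrN. Qed.

Lemma ler_normcB z w : normc (z - w) <= normc z + normc w.
Proof. by rewrite (le_trans (ler_normcD _ _)) // normc_opp. Qed.

Lemma normc_sub_le z w : normc z - normc w <= normc (z - w).
Proof. by rewrite lerBlDr -{1}(subrK w z) ler_normcD. Qed.

Lemma normc_gt0 z : z != 0 -> 0 < normc z.
Proof.
move=> z0; rewrite lt_neqAle normc_ge0 andbT eq_sym.
by apply: contra z0 => /eqP/eq0_normc ->.
Qed.

Lemma normc_sum (I : Type) (s : seq I) (F : I -> C) :
  normc (\sum_(i <- s) F i) <= \sum_(i <- s) normc (F i).
Proof.
elim: s => [|i s IH]; first by rewrite !big_nil normc0.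
by rewrite !big_cons (le_trans (ler_normcD _ _)) // lerD2l.
Qed.

Lemma Re_add z w : complex.Re (z + w) = complex.Re z + complex.Re w.
Proof. by case: z w => a b []. Qed.

Lemma Im_add z w : complex.Im (z + w) = complex.Im z + complex.Im w.
Proof. by case: z w => a b []. Qed.

Lemma Re_sum (I : Type) (s : seq I) (F : I -> C) :
  complex.Re (\sum_(i <- s) F i) = \sum_(i <- s) complex.Re (F i).
Proof. by apply: (big_morph _ Re_add). Qed.

Lemma Im_sum (I : Type) (s : seq I) (F : I -> C) :
  complex.Im (\sum_(i <- s) F i) = \sum_(i <- s) complex.Im (F i).
Proof. by apply: (big_morph _ Im_add). Qed.

Lemma normc_expi (t : R) : normc (expi t) = 1.
Proof. by rewrite /normc /expi cos2Dsin2 sqrtr1. Qed.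

Lemma expiD (s t : R) : expi (s + t) = expi s * expi t.
Proof.
apply/eqP; rewrite eq_complex /= cosD sinD.
by apply/andP; split; apply/eqP; ring.
Qed.

Lemma expi0 : expi (0 : R) = 1.
Proof. by rewrite /expi cos0 sin0. Qed.

Lemma expiX (t : R) n : expi t ^+ n = expi (n%:R * t).
Proof.
elim: n => [|n IH]; first by rewrite expr0 mul0r expi0.
by rewrite exprS IH -expiD -natr1 mulrDl mul1r addrC.
Qed.

Lemma expi_neq0 (t : R) : expi t != 0.
Proof.
by apply/eqP => e; have := normc_expi t; rewrite e normc0 => /eqP; rewrite eq_sym oner_eq0.
Qed.

End Modulus.

(** * Complex series dominated by a geometric series of ratio one half *)

Section ComplexSeries.
Variable R : realType.
Local Notation C := R[i].

(** Convergence with real tolerances: the norm of [R[i]] has its values in [R[i]], while all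
    estimates here are real inequalities on [normc]. *)
Definition ccvg (u : nat -> C) (l : C) : Prop :=
  forall e : R, 0 < e -> exists N, forall n, (N <= n)%N -> normc (u n - l) <= e.

Local Notation h k := ((2^-1 : R) ^+ k).

Lemma half_pow_gt0 k : 0 < h k. Proof. by rewrite exprn_gt0 // invr_gt0. Qed.

Lemma half_pow_le1 k : h k <= 1.
Proof. by rewrite exprn_ile1 // ?invr_ge0 // invf_le1 // ler1n. Qed.

Lemma geometric_half_sum m n : (m <= n)%N -> \sum_(m <= k < n) h k = 2 * h m - 2 * h n.
Proof.
move=> /subnK <-; elim: (n - m)%N => [|j IH].
  by rewrite add0n big_geq // subrr.
rewrite addSn big_nat_recr ?leq_addl //= IH exprS.
by rewrite !mulrA divff // mul1r; ring.
Qed.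

Lemma half_pow_small (e : R) : 0 < e -> exists N, forall n, (N <= n)%N -> h n <= e.
Proof.
move=> e0; have : h n @[n --> \oo] --> (0 : R).
  by apply: cvg_expr; rewrite ger0_norm ?invr_ge0 // invf_lt1 // ltr1n.
move/cvgrPdist_le => /(_ e e0) [N _ HN]; exists N => n /HN.
by rewrite /= sub0r normrN ger0_norm // ltW // half_pow_gt0.
Qed.

Lemma ccvg_unique u l l' : ccvg u l -> ccvg u l' -> l = l'.
Proof.
move=> H1 H2; apply/eqP/negPn/negP => nl.
have d0 : 0 < normc (l - l') by apply: normc_gt0; rewrite subr_eq0.
have e0 : 0 < normc (l - l') / 4 by rewrite divr_gt0.
have [N1 /(_ (maxn N1 _) (leq_maxl _ _)) K1] := H1 _ e0.
have [N2 /(_ (maxn _ N2) (leq_maxr _ _)) K2] := H2 _ e0.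
have := K2 N1; have := K1 N2; set n := maxn N1 N2 => A B.
have : normc (l - l') <= normc (u n - l') + normc (u n - l).
  have -> : l - l' = (u n - l') - (u n - l) by ring.
  exact: ler_normcB.
lra.
Qed.

Lemma ccvg_cst l : ccvg (fun=> l) l.
Proof. by move=> e e0; exists 0%N => n _; rewrite subrr normc0 ltW. Qed.

Lemma ccvgD u v l l' : ccvg u l -> ccvg v l' -> ccvg (fun n => u n + v n) (l + l').
Proof.
move=> H1 H2 e e0; have e2 : 0 < e / 2 by rewrite divr_gt0.
have [N1 K1] := H1 _ e2; have [N2 K2] := H2 _ e2.
exists (maxn N1 N2) => n; rewrite geq_max => /andP[/K1 a /K2 b].
have -> : u n + v n - (l + l') = (u n - l) + (v n - l') by ring.
by apply: (le_trans (ler_normcD _ _)); lra.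
Qed.

Lemma ccvgZ a u l : ccvg u l -> ccvg (fun n => a * u n) (a * l).
Proof.
move=> H e e0; have a0 := normc_ge0 a.
have e2 : 0 < e / (normc a + 1) by rewrite divr_gt0 // ltr_wpDl.
have [N K] := H _ e2; exists N => n /K; rewrite -mulrBr normcM => b.
apply: (@le_trans _ _ (normc a * (e / (normc a + 1)))); first by rewrite ler_wpM2l.
by rewrite mulrA ler_pdivrMr ?ltr_wpDl // mulrDr mulr1 mulrC lerDl ltW.
Qed.

Lemma ccvg_le u l (a : R) N : (forall n, (N <= n)%N -> normc (u n) <= a) ->
  ccvg u l -> normc l <= a.
Proof.
move=> H K; apply/ler_addgt0Pr => e e0; have [M HM] := K _ e0.
have A := HM _ (leq_maxr N M); have B := H _ (leq_maxl N M).
have -> : l = u (maxn N M) - (u (maxn N M) - l) by ring.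
by apply: (le_trans (ler_normcB _ _)); lra.
Qed.

Lemma real_series_half (x : nat -> R) (A : R) K :
  (forall k, (K <= k)%N -> `|x k| <= A * h k) ->
  exists l, forall e, 0 < e -> exists N, forall n, (N <= n)%N ->
    `|\sum_(0 <= k < n) x k - l| <= e.
Proof.
move=> H.
have : cvgn (series x).
  apply: normed_cvg.
  (* The domination starts only at [K]; below it the comparison sequence copies [|x k|], and
     summability depends on the tail alone. *)
  pose y k := if (k < K)%N then `|x k| else A * h k.
  apply: (@series_le_cvg _ _ y).
  - by move=> n /=.
  - move=> n; rewrite /y; case: ltnP => // /H; apply: le_trans; exact: normr_ge0.
  - by move=> n; rewrite /y /=; case: ltnP => // /H.
  have : cvgn (series (geometric A (2^-1 : R))).
    by apply: is_cvg_geometric_series; rewrite ger0_norm ?invr_ge0 // invf_lt1 // ltr1n.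
  rewrite -(is_cvg_series_restrict K) => c2.
  rewrite -(is_cvg_series_restrict K).
  rewrite (_ : (fun n => _) = (fun n => \sum_(K <= k < n) (geometric A (2^-1 : R)) k)) //.
  apply/funext => n; rewrite big_nat_cond [RHS]big_nat_cond; apply: eq_bigr => i.
  by rewrite /y andbT => /andP[Ki _]; rewrite ltnNge Ki.
move=> /cvg_ex [l Hl]; exists l => e e0.
move/cvgrPdist_le : Hl => /(_ e e0) [N _ HN]; exists N => n /HN.
by rewrite /= distrC.
Qed.

Lemma complex_series_half (u : nat -> C) (A : R) K :
  (forall k, (K <= k)%N -> normc (u k) <= A * h k) ->
  exists l, ccvg (fun n => \sum_(0 <= k < n) u k) l.
Proof.
move=> H.
have [a Ha] : exists a, forall e, 0 < e -> exists N, forall n, (N <= n)%N ->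
    `|\sum_(0 <= k < n) complex.Re (u k) - a| <= e.
  apply: real_series_half => k /H; apply: le_trans; exact: Re_le_normc.
have [b Hb] : exists a, forall e, 0 < e -> exists N, forall n, (N <= n)%N ->
    `|\sum_(0 <= k < n) complex.Im (u k) - a| <= e.
  apply: real_series_half => k /H; apply: le_trans; exact: Im_le_normc.
exists (Complex a b) => e e0; have e2 : 0 < e / 2 by rewrite divr_gt0.
have [N1 K1] := Ha _ e2; have [N2 K2] := Hb _ e2.
exists (maxn N1 N2) => n; rewrite geq_max => /andP[/K1 p /K2 q].
apply: (le_trans (normc_le_ReIm _)).
have -> : complex.Re (\sum_(0 <= k < n) u k - Complex a b) =
    \sum_(0 <= k < n) complex.Re (u k) - a.
  have -> : \sum_(0 <= k < n) complex.Re (u k) = complex.Re (\sum_(0 <= k < n) u k).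
    by rewrite Re_sum.
  by case: (\sum_(0 <= k < n) u k).
have -> : complex.Im (\sum_(0 <= k < n) u k - Complex a b) =
    \sum_(0 <= k < n) complex.Im (u k) - b.
  have -> : \sum_(0 <= k < n) complex.Im (u k) = complex.Im (\sum_(0 <= k < n) u k).
    by rewrite Im_sum.
  by case: (\sum_(0 <= k < n) u k).
lra.
Qed.

Lemma normc_tail_half (u : nat -> C) (A : R) K m n :
  0 <= A -> (forall k, (K <= k)%N -> normc (u k) <= A * h k) ->
  (K <= m)%N -> (m <= n)%N ->
  normc (\sum_(0 <= k < n) u k - \sum_(0 <= k < m) u k) <= 2 * A * h m.
Proof.
move=> A0 H Km mn; rewrite (big_cat_nat (leq0n m) mn) /= addrAC subrr add0r.
apply: (le_trans (normc_sum _ _)).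
apply: (@le_trans _ _ (\sum_(m <= k < n) A * h k)).
  by rewrite big_nat_cond [leRHS]big_nat_cond; apply: ler_sum => i;
    rewrite andbT => /andP[mi _]; apply: H; exact: leq_trans mi.
rewrite -mulr_sumr geometric_half_sum // mulrBr.
have := mulr_ge0 A0 (ltW (half_pow_gt0 n)); lra.
Qed.

Lemma ccvg_tail_half (u : nat -> C) (A : R) K m l :
  0 <= A -> (forall k, (K <= k)%N -> normc (u k) <= A * h k) -> (K <= m)%N ->
  ccvg (fun n => \sum_(0 <= k < n) u k) l ->
  normc (l - \sum_(0 <= k < m) u k) <= 2 * A * h m.
Proof.
move=> A0 H Km cl.
apply: (@ccvg_le (fun n => \sum_(0 <= k < n) u k - \sum_(0 <= k < m) u k) _ _ m).
  by move=> n mn; apply: normc_tail_half Km mn.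
by apply: (ccvgD cl); apply: ccvg_cst.
Qed.

End ComplexSeries.

(** * Uniform second order control of holomorphic functions *)

Section QuadraticControl.
Variable R : realType.
Local Notation C := R[i].
Local Notation h k := ((2^-1 : R) ^+ k).

(* [u] has derivative [u'] on the closed disc of radius [r] and [a] controls
   values, slopes and second order Taylor remainders; unlike differentiability
   this passes to pointwise limits. *)
Definition quad_control (r a : R) (u u' : C -> C) : Prop :=
  forall z w, normc z <= r -> normc w <= r ->
    [/\ normc (u z) <= a, normc (u' z) <= a,
        normc (u w - u z) <= a * normc (w - z) &
        normc (u w - u z - u' z * (w - z)) <= a * normc (w - z) ^+ 2].

Lemma quad_control_le r a b u u' : a <= b ->
  quad_control r a u u' -> quad_control r b u u'.
Proof.
move=> ab H z w zr wr; have [H1 H2 H3 H4] := H z w zr wr.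
split; [exact: le_trans ab|exact: le_trans ab| |].
- by apply: (le_trans H3); rewrite ler_wpM2r // normc_ge0.
- by apply: (le_trans H4); rewrite ler_wpM2r // exprn_ge0 // normc_ge0.
Qed.

Lemma quad_control_sub r s a u u' : r <= s ->
  quad_control s a u u' -> quad_control r a u u'.
Proof. by move=> rs H z w zr wr; apply: H; exact: le_trans rs. Qed.

Lemma quad_control_cst r c : quad_control r (normc c) (fun=> c) (fun=> 0).
Proof.
move=> z w zr wr; rewrite !subrr mul0r subrr normc0.
by split; rewrite ?mulr_ge0 ?exprn_ge0 ?normc_ge0.
Qed.

Lemma quad_control_id r : r <= 1 -> quad_control r 1 (fun z => z) (fun=> 1).
Proof.
move=> r1 z w zr wr; rewrite !mul1r subrr normc0 normc1.
by split => //; [exact: le_trans r1|rewrite exprn_ge0 // normc_ge0].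
Qed.

Lemma quad_controlD r a b u u' v v' :
  quad_control r a u u' -> quad_control r b v v' ->
  quad_control r (a + b) (fun z => u z + v z) (fun z => u' z + v' z).
Proof.
move=> Hu Hv z w zr wr.
have [A1 A2 A3 A4] := Hu z w zr wr; have [B1 B2 B3 B4] := Hv z w zr wr.
have -> : u w + v w - (u z + v z) = (u w - u z) + (v w - v z) by ring.
have -> : (u w - u z) + (v w - v z) - (u' z + v' z) * (w - z) =
  (u w - u z - u' z * (w - z)) + (v w - v z - v' z * (w - z)) by ring.
by split; apply: (le_trans (ler_normcD _ _)); rewrite ?mulrDl lerD.
Qed.

(** The factor 3 counts the products in the Taylor remainder of [u v]: the remainder of [u] times
    [v], the linear part of [u] times the increment of [v], and [u] times the remainder of [v]. *)
Lemma quad_controlM r a b u u' v v' :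
  quad_control r a u u' -> quad_control r b v v' ->
  quad_control r (3 * (a * b)) (fun z => u z * v z)
    (fun z => u' z * v z + u z * v' z).
Proof.
move=> Hu Hv z w zr wr.
have [A1 A2 A3 A4] := Hu z w zr wr; have [B1 B2 B3 B4] := Hv z w zr wr.
have [B1w _ _ _] := Hv w z wr zr.
have [n0 n1 n2 n3] := And4 (normc_ge0 (u z)) (normc_ge0 (v z))
  (normc_ge0 (u' z)) (normc_ge0 (w - z)).
have a0 := le_trans n0 A1; have b0 := le_trans n1 B1.
have ab0 : 0 <= a * b by rewrite mulr_ge0.
have pM (x y : C) p q : normc x <= p -> normc y <= q -> normc (x * y) <= p * q.
  by move=> ? ?; rewrite normcM ler_pM // normc_ge0.
split.
- by apply: (le_trans (pM _ _ _ _ A1 B1)); lra.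
- apply: (le_trans (ler_normcD _ _)).
  by have := pM _ _ _ _ A2 B1; have := pM _ _ _ _ A1 B2; lra.
- have -> : u w * v w - u z * v z = (u w - u z) * v w + u z * (v w - v z) by ring.
  apply: (le_trans (ler_normcD _ _)).
  have := pM _ _ _ _ A3 B1w; have := pM _ _ _ _ A1 B3.
  have : 0 <= (a * b) * normc (w - z) by rewrite mulr_ge0.
  lra.
- have -> : u w * v w - u z * v z - (u' z * v z + u z * v' z) * (w - z) =
    (u w - u z - u' z * (w - z)) * v w + (u' z * (w - z)) * (v w - v z)
    + u z * (v w - v z - v' z * (w - z)) by ring.
  apply: (le_trans (ler_normcD _ _)).
  have := ler_normcD ((u w - u z - u' z * (w - z)) * v w) ((u' z * (w - z)) * (v w - v z)).
  have := pM _ _ _ _ A4 B1w; have := pM _ _ _ _ A1 B4.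
  have := pM _ _ _ _ (pM _ _ _ _ A2 (lexx (normc (w - z)))) B3.
  lra.
Qed.

(** The difference of two inverses is [(u w - u z)] times both inverses, which gives the slope bound
    [a b^2]. In the remainder, replacing [(1 - u w)^-1] by [(1 - u z)^-1] costs that slope bound
    once more, times [a b]; this is the summand [a^2 b^3]. *)
Lemma quad_controlV r a b u u' : quad_control r a u u' ->
  (forall z, normc z <= r -> 1 - u z != 0 /\ normc (1 - u z)^-1 <= b) ->
  quad_control r (b + a * b ^+ 2 + a ^+ 2 * b ^+ 3)
    (fun z => (1 - u z)^-1) (fun z => u' z * (1 - u z)^-1 ^+ 2).
Proof.
move=> Hu Hb z w zr wr.
have [A1 A2 A3 A4] := Hu z w zr wr.
have [z0 bz] := Hb z zr; have [w0 bw] := Hb w wr.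
have [n0 n1 n2 n3] := And4 (normc_ge0 (u z)) (normc_ge0 (1 - u z)^-1)
  (normc_ge0 (u' z)) (normc_ge0 (w - z)).
have a0 := le_trans n0 A1; have b0 := le_trans n1 bz.
have pM (x y : C) p q : normc x <= p -> normc y <= q -> normc (x * y) <= p * q.
  by move=> ? ?; rewrite normcM ler_pM // normc_ge0.
have c1 : 0 <= a * b ^+ 2 by rewrite mulr_ge0 // exprn_ge0.
have c2 : 0 <= a ^+ 2 * b ^+ 3 by rewrite mulr_ge0 // exprn_ge0.
have D : normc ((1 - u w)^-1 - (1 - u z)^-1) <= a * b ^+ 2 * normc (w - z).
  have -> : (1 - u w)^-1 - (1 - u z)^-1 = (u w - u z) * ((1 - u w)^-1 * (1 - u z)^-1).
    by field; apply/andP.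
  apply: (le_trans (pM _ _ _ _ A3 (pM _ _ _ _ bw bz))).
  by rewrite expr2 mulrAC.
split.
- lra.
- apply: (@le_trans _ _ (a * b ^+ 2)); last lra.
  by rewrite expr2 [b ^+ 2]expr2; exact: pM _ _ _ _ A2 (pM _ _ _ _ bz bz).
- apply: (le_trans D); rewrite ler_wpM2r //; lra.
- have -> : (1 - u w)^-1 - (1 - u z)^-1 - u' z * (1 - u z)^-1 ^+ 2 * (w - z) =
    (u w - u z - u' z * (w - z)) * ((1 - u w)^-1 * (1 - u z)^-1)
    + (u' z * (w - z) * (1 - u z)^-1) * ((1 - u w)^-1 - (1 - u z)^-1).
    by field; apply/andP.
  apply: (le_trans (ler_normcD _ _)).
  have E1 := pM _ _ _ _ A4 (pM _ _ _ _ bw bz).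
  have E2 := pM _ _ _ _ (pM _ _ _ _ (pM _ _ _ _ A2 (lexx (normc (w - z)))) bz) D.
  have E3 : 0 <= b * normc (w - z) ^+ 2 by rewrite mulr_ge0 // exprn_ge0.
  have := lerD E1 E2; move=> /le_trans; apply.
  rewrite !mulrDl -!addrA; lra.
Qed.

(** The exponent is written [n.+2] because the remainder behaves like a second derivative and keeps
    only [r^n]. For [r < 1] the constant tends to 0 with [n], which is the source of all smallness
    inside the disc. *)
Lemma quad_controlX r n : 0 <= r <= 1 ->
  quad_control r ((n.+2)%:R ^+ 2 * r ^+ n)
    (fun z => z ^+ n.+2) (fun z => n.+2%:R * z ^+ n.+1).
Proof.
move=> /andP[r0 r1] z w zr wr.
have nX x m : normc x <= r -> normc (x ^+ m) <= r ^+ m.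
  by move=> xr; rewrite normcX lerXn2r // nnegrE ?normc_ge0.
have rm m : 0 <= r ^+ m by rewrite exprn_ge0.
have nn : (1:R) <= n.+2%:R by rewrite ler1n.
have rS m : r ^+ m.+1 <= r ^+ m by rewrite exprS ler_piMl.
have d0 := normc_ge0 (w - z).
have L m : normc (w ^+ m.+1 - z ^+ m.+1) <= m.+1%:R * r ^+ m * normc (w - z).
  elim: m => [|m IH]; first by rewrite !expr1 expr0 !mul1r.
  have -> : w ^+ m.+2 - z ^+ m.+2 = w * (w ^+ m.+1 - z ^+ m.+1) + z ^+ m.+1 * (w - z).
    by rewrite (exprS w m.+1) (exprS z m.+1); ring.
  apply: (le_trans (ler_normcD _ _)); rewrite !normcM.
  have E1 : normc w * normc (w ^+ m.+1 - z ^+ m.+1) <=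
     r * (m.+1%:R * r ^+ m * normc (w - z)) by rewrite ler_pM // normc_ge0.
  have E2 : normc (z ^+ m.+1) * normc (w - z) <= r ^+ m.+1 * normc (w - z).
    by rewrite ler_wpM2r // nX.
  rewrite -[m.+2%:R]natr1; move: E1 E2; rewrite !exprS; lra.
have T m : normc (w ^+ m.+2 - z ^+ m.+2 - m.+2%:R * z ^+ m.+1 * (w - z)) <=
    m.+2%:R ^+ 2 * r ^+ m * normc (w - z) ^+ 2.
  elim: m => [|m IH].
    have -> : w ^+ 2 - z ^+ 2 - 2%:R * z ^+ 1 * (w - z) = (w - z) ^+ 2 by ring.
    rewrite normcX expr0 mulr1 ler_peMl ?exprn_ge0 //; lra.
  have -> : w ^+ m.+3 - z ^+ m.+3 - m.+3%:R * z ^+ m.+2 * (w - z) =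
    w * (w ^+ m.+2 - z ^+ m.+2 - m.+2%:R * z ^+ m.+1 * (w - z)) +
    m.+2%:R * z ^+ m.+1 * (w - z) ^+ 2.
    by rewrite (exprS w m.+2) (exprS z m.+2) (exprS z m.+1) -(natr1 m.+2); ring.
  apply: (le_trans (ler_normcD _ _)); rewrite (normcM w) (normcM _ ((w - z) ^+ 2)) (normcM m.+2%:R).
  have E1 := ler_pM (normc_ge0 _) (normc_ge0 _) wr IH.
  have E2 : normc m.+2%:R * normc (z ^+ m.+1) * normc ((w - z) ^+ 2) <=
      m.+2%:R * r ^+ m.+1 * normc (w - z) ^+ 2.
    rewrite (normcX (w - z)) ler_wpM2r ?exprn_ge0 // ler_pM ?normc_ge0 ?nX //.
    by have := normc_real (m.+2%:R : R); rewrite rmorph_nat => ->; rewrite ger0_norm.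
  apply: (le_trans (lerD E1 E2)).
  rewrite -(natr1 m.+2) (exprS r m).
  set y := r * r ^+ m; set q := normc (w - z) ^+ 2; set x : R := m.+2%:R.
  have -> : r * (x ^+ 2 * r ^+ m * q) = x ^+ 2 * (y * q) by rewrite /y; ring.
  have : 0 <= y * q by rewrite mulr_ge0 ?mulr_ge0 ?exprn_ge0.
  have : 0 <= x by rewrite ler0n.
  rewrite -(mulrA x y q) -(mulrA _ y q); move: (y * q) x => p x x0 p0.
  have : 0 <= x * p by rewrite mulr_ge0.
  nra.
split.
- apply: (le_trans (nX _ _ zr)); apply: (le_trans (rS _)); apply: (le_trans (rS _)).
  by rewrite ler_peMl // exprn_ege1.
- rewrite normcM; have := normc_real (n.+2%:R : R); rewrite rmorph_nat => ->.
  rewrite ger0_norm // expr2 -mulrA ler_wpM2l //.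
  apply: (le_trans (nX _ _ zr)); apply: (le_trans (rS _)).
  by rewrite ler_peMl.
- apply: (le_trans (L _)); rewrite ler_wpM2r // expr2 -mulrA ler_wpM2l //.
  by apply: (le_trans (rS _)); rewrite ler_peMl.
- exact: T.
Qed.

(** The radius is 1, so the same constant is a Lipschitz constant up to the unit circle; the
    boundary estimates on cones rest on this. *)
Lemma quad_control_poly (P : {poly C}) :
  exists a, 0 <= a /\ quad_control 1 a (horner P) (horner P^`()).
Proof.
elim/poly_ind: P => [|P c [a [a0 Ha]]].
  exists 0; split=> // z w _ _; rewrite deriv0 !horner0 !subrr !mul0r !subrr normc0.
  by split.
exists (3 * (a * 1) + normc c); split.
  by rewrite addr_ge0 ?normc_ge0 // !mulr_ge0.
have := quad_controlD (quad_controlM Ha (quad_control_id (lexx 1))) (@quad_control_cst 1 c).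
have -> : (fun z : C => P.[z] * z + c) = horner (P * 'X + c%:P).
  by apply/funext => z; rewrite !hornerE.
have -> // : (fun z : C => P^`().[z] * z + P.[z] * 1 + 0) = horner (P * 'X + c%:P)^`().
apply/funext => z; rewrite derivD derivM derivX derivC !hornerE; ring.
Qed.

(** The inequality [(1 - x)^n <= 1 / (1 + n x)] without division. Each induction step uses
    [(1 - x) (1 + (n + 1) x) <= 1 + n x]. All decay rates of powers below are drawn from it. *)
Lemma bernoulli_inv (x : R) n : 0 <= x <= 1 -> (1 - x) ^+ n * (1 + n%:R * x) <= 1.
Proof.
move=> /andP[x0 x1]; elim: n => [|n IH]; first by rewrite expr0 mul0r addr0 mulr1.
apply: le_trans IH; rewrite exprSr -mulrA ler_wpM2l ?exprn_ge0 ?subr_ge0 //.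
rewrite -natr1; have := ler0n R n; set y : R := n%:R => y0.
have : 0 <= y * (x * x) by rewrite !mulr_ge0.
nra.
Qed.

Lemma pow_small (x e : R) : 0 < x <= 1 -> 0 < e ->
  exists M0, forall M, (M0 <= M)%N -> (1 - x) ^+ M <= e.
Proof.
move=> /andP[x0 x1] e0; exists (Num.truncn (x * e)^-1).+1 => M HM.
have := @bernoulli_inv x M; rewrite (ltW x0) x1 => /(_ isT).
have p0 : 0 <= (1 - x) ^+ M by rewrite exprn_ge0 // subr_ge0.
have xe : 0 < x * e by rewrite mulr_gt0.
have : (x * e)^-1 < M%:R.
  by apply: (lt_le_trans (truncnS_gt _)); rewrite ler_nat.
rewrite -div1r ltr_pdivrMr // => Mx H.
have : 0 <= (1 - x) ^+ M * (M%:R * (x * e) - 1) by rewrite mulr_ge0 // subr_ge0 ltW.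
have := mulr_ge0 p0 (ltW e0).
have : 0 <= e * (1 - (1 - x) ^+ M * (1 + M%:R * x)) by rewrite mulr_ge0 ?subr_ge0 // ltW.
nra.
Qed.

Lemma natmul_pow_small (r e : R) : 0 <= r < 1 -> 0 < e ->
  exists M0, forall M, (M0 <= M)%N -> M.+2%:R ^+ 2 * r ^+ M <= e.
Proof.
move=> /andP[r0 r1] e0.
(* With [s = 1 - x] one has [r <= s^3]. Two of the three factors [s^M] absorb [(M + 2)^2], since
   [(M + 2) s^M <= 2 / x], and the third supplies the smallness. *)
have [x [x0 x1 rx]] : exists x, [/\ 0 < x, x <= 1 & r = 1 - 3 * x].
  by exists ((1 - r) / 3); split; lra.
have [M0 HM0] := @pow_small x (e * (x / 2) ^+ 2) ltac:(by rewrite x0)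
  ltac:(by rewrite mulr_gt0 // exprn_gt0 // divr_gt0).
exists M0 => M /HM0; set s := 1 - x => sM.
have s0 : 0 <= s by rewrite subr_ge0.
have rs : r <= s ^+ 3.
  rewrite rx; have -> : s ^+ 3 = 1 - 3 * x + x * x * (3 - x) by rewrite /s; ring.
  by rewrite lerDl mulr_ge0 ?mulr_ge0 //; lra.
have sM0 : 0 <= s ^+ M by rewrite exprn_ge0.
have Ms : M.+2%:R * s ^+ M * (x / 2) <= 1.
  have := @bernoulli_inv x M; rewrite (ltW x0) x1 -/s => /(_ isT).
  rewrite -natr1 -(natr1 M); have := ler0n R M; set y : R := M%:R => y0.
  have : 0 <= s ^+ M * (1 - x) by rewrite mulr_ge0.
  have : 0 <= s ^+ M * (y * x) by rewrite !mulr_ge0 // ltW.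
  move: (s ^+ M) => q; lra.
have -> : e = e * (x / 2) ^+ 2 * ((x / 2) ^+ 2)^-1.
  by rewrite mulfK // expf_neq0 // mulf_neq0 ?invr_neq0 ?gt_eqF.
rewrite ler_pdivlMr ?exprn_gt0 ?divr_gt0 //.
apply: le_trans sM.
have rsM : r ^+ M <= (s ^+ M) ^+ 3 by rewrite exprAC lerXn2r // nnegrE exprn_ge0.
move: rsM sM0 Ms; have := ler0n R M.+2; set p : R := M.+2%:R.
have : 0 <= x / 2 by rewrite divr_ge0 // ltW.
move: (x / 2) (s ^+ M) (r ^+ M) => y q t y0 p0 tq q0 pq.
apply: (@le_trans _ _ ((p * q * y) ^+ 2 * q)).
  have -> : (p * q * y) ^+ 2 * q = p ^+ 2 * q ^+ 3 * y ^+ 2 by ring.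
  by rewrite ler_wpM2r ?exprn_ge0 // ler_wpM2l ?exprn_ge0.
by rewrite ler_piMl // exprn_ile1 // !mulr_ge0.
Qed.

End QuadraticControl.

(** * Limits in cones and the terms of the series *)

Section Terms.
Variable R : realType.
Local Notation C := R[i].
Local Notation h k := ((2^-1 : R) ^+ k).

Implicit Types (z w zeta : C).

Lemma taylor_derivable (f : C -> C) (z d : C) (r a : R) :
  0 <= a -> normc z < r ->
  (forall w, normc w <= r -> normc (f w - f z - d * (w - z)) <= a * normc (w - z) ^+ 2) ->
  @derivable C C C f z 1.
Proof.
move=> a0 zr H; apply/cvg_ex; exists d.
apply/cvgrPdist_le => e e0.
have eR : e = ((complex.Re e)%:C)%C.
  by move: e0; rewrite ltcE => /andP[/eqP i0 _]; case: e i0 => x y /= ->.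
have e1 : 0 < complex.Re e by rewrite eR ltcR in e0.
near=> x.
have x0 : x != 0 by near: x; exact: nbhs_dnbhs_neq.
have xs : `|x| < ((Num.min (r - normc z) (complex.Re e / (a + 1)))%:C)%C.
  near: x; apply: dnbhs0_lt; rewrite ltcR lt_min subr_gt0 zr /=.
  by rewrite divr_gt0 // ltr_wpDl.
move: xs; rewrite norm_normc ltcR lt_min => /andP[xs1 xs2].
have := H (z + x); rewrite [z + x - z]addrC addKr => Hx.
have {}Hx : normc (f (z + x) - f z - d * x) <= a * normc x ^+ 2.
  by apply: Hx; apply: (le_trans (ler_normcD _ _)); lra.
have nx := normc_gt0 x0.
rewrite norm_normc eR lecR /= addrC -[x *: 1]/(x * 1) mulr1.
rewrite -[x^-1 *: _]/(x^-1 * _) (addrC x z).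
have -> : - (x^-1 * (f (z + x) - f z)) + d = - (x^-1 * (f (z + x) - f z - d * x)).
  by field.
rewrite normc_opp normcM normcV ler_pdivrMl //.
apply: (le_trans Hx); rewrite expr2 mulrCA ler_wpM2l ?ltW //.
have : normc x * (a + 1) < complex.Re e by rewrite -ltr_pdivlMr // ltr_wpDl.
lra.
Unshelve. all: by end_near. Qed.

(** The nontangential approach region of aperture [A]. It compares [|z - zeta|] with [1 - |z|]
    directly, which is what the estimates on powers of [z] consume. *)
Definition cone (A : R) (zeta z : C) : Prop :=
  normc z < 1 /\ normc (z - zeta) <= A * (1 - normc z).

(** On the circle this is the nontangential limit over all apertures. At [zeta = 0] the cones with
    [A > 0] contain a neighbourhood of [0], so there it expresses continuity with value [L]; the
    independence argument at the end uses it in that form. *)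
Definition NTlim (f : C -> C) (zeta L : C) : Prop :=
  forall A e, 0 < e -> exists d, 0 < d /\
    forall z, cone A zeta z -> normc (z - zeta) < d -> normc (f z - L) <= e.

Lemma NTlim_cst zeta L : NTlim (fun=> L) zeta L.
Proof. by move=> A e e0; exists 1; split=> // z _ _; rewrite subrr normc0 ltW. Qed.

Lemma NTlimD f g zeta L M : NTlim f zeta L -> NTlim g zeta M ->
  NTlim (fun z => f z + g z) zeta (L + M).
Proof.
move=> Hf Hg A e e0; have e2 : 0 < e / 2 by rewrite divr_gt0.
have [d1 [p1 H1]] := Hf A _ e2; have [d2 [p2 H2]] := Hg A _ e2.
exists (Num.min d1 d2); split; first by rewrite lt_min p1.
move=> z cz; rewrite lt_min => /andP[/(H1 z cz) a /(H2 z cz) b].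
have -> : f z + g z - (L + M) = (f z - L) + (g z - M) by ring.
by apply: (le_trans (ler_normcD _ _)); lra.
Qed.

Lemma NTlim_sum (B : nat -> C -> C) zeta (L : nat -> C) n :
  (forall k, NTlim (B k) zeta (L k)) ->
  NTlim (fun z => \sum_(0 <= k < n) B k z) zeta (\sum_(0 <= k < n) L k).
Proof.
move=> H; elim: n => [|n IH].
  rewrite big_geq // (_ : (fun z => _) = fun=> 0); first exact: NTlim_cst.
  by apply/funext => z; rewrite big_geq.
rewrite big_nat_recr //= (_ : (fun z => _) = fun z => \sum_(0 <= k < n) B k z + B n z).
  exact: NTlimD.
by apply/funext => z; rewrite big_nat_recr.
Qed.

Lemma NTlimM f g zeta L M : NTlim f zeta L -> NTlim g zeta M ->
  NTlim (fun z => f z * g z) zeta (L * M).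
Proof.
move=> Hf Hg A e e0; have [l0 m0] := conj (normc_ge0 L) (normc_ge0 M).
pose t := Num.min 1 (e / (normc L + normc M + 1)).
have s0 : 0 < normc L + normc M + 1 by rewrite ltr_wpDl // addr_ge0.
have t0 : 0 < t by rewrite lt_min ltr01 divr_gt0.
have [d1 [p1 H1]] := Hf A _ t0; have [d2 [p2 H2]] := Hg A _ t0.
exists (Num.min d1 d2); split; first by rewrite lt_min p1.
move=> z cz; rewrite lt_min => /andP[/(H1 z cz) a /(H2 z cz) b].
have -> : f z * g z - L * M = (f z - L) * (g z - M) + (L * (g z - M) + M * (f z - L)) by ring.
apply: (le_trans (ler_normcD _ _)).
have := ler_normcD (L * (g z - M)) (M * (f z - L)); rewrite !normcM => H.
have t1 : t <= 1 by rewrite ge_min lexx.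
have te : t * (normc L + normc M + 1) <= e by rewrite -ler_pdivlMr // ge_min lexx orbT.
have := ler_wpM2l l0 b; have := ler_wpM2l m0 a.
have := ler_pM (normc_ge0 _) (normc_ge0 _) a b.
have : t * t <= t by rewrite ler_piMl // ltW.
lra.
Qed.

Lemma quad_control_NTlim f f' a zeta : 0 <= a -> quad_control 1 a f f' ->
  normc zeta = 1 -> NTlim f zeta (f zeta).
Proof.
move=> a0 H z1 A e e0; exists (e / (a + 1)); split; first by rewrite divr_gt0 // ltr_wpDl.
move=> z [zd _]; rewrite ltr_pdivlMr ?ltr_wpDl // => zs.
have [_ _ L _] := H zeta z ltac:(by rewrite z1) (ltW zd).
have := normc_ge0 (z - zeta); lra.
Qed.

Lemma poly_NTlim (P : {poly C}) zeta : normc zeta = 1 -> NTlim (horner P) zeta P.[zeta].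
Proof. by move=> z1; have [a [a0 H]] := quad_control_poly P; exact: quad_control_NTlim H z1. Qed.

Lemma NTlimV f zeta L : L != 0 -> NTlim f zeta L -> NTlim (fun z => (f z)^-1) zeta L^-1.
Proof.
move=> L0 Hf A e e0; have n0 := normc_gt0 L0; set l := normc L in n0.
pose t := Num.min (l / 2) (e * (l / 2) * l).
have t0 : 0 < t by rewrite lt_min divr_gt0 // !mulr_gt0 // invr_gt0.
have [d [p H]] := Hf A _ t0; exists d; split => // z cz /(H z cz) a.
have t1 : t <= l / 2 by rewrite ge_min lexx.
have t2 : t <= e * (l / 2) * l by rewrite ge_min lexx orbT.
have fl : l / 2 <= normc (f z).
  have := normc_sub_le L (f z); rewrite normcB -/l; lra.
have fz0 : f z != 0.
  by apply/eqP => E; move: fl; rewrite E normc0; apply/negP; rewrite -ltNge divr_gt0.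
have -> : (f z)^-1 - L^-1 = (L - f z) * ((f z)^-1 * L^-1) by field; apply/andP.
rewrite !normcM !normcV -/l -invfM ler_pdivrMr ?mulr_gt0 ?normc_gt0 // normcB.
apply: (le_trans a); apply: (le_trans t2).
by rewrite -(mulrA e) ler_wpM2l ?(ltW e0) // ler_wpM2r // ltW.
Qed.

Lemma NTlimX n zeta : normc zeta = 1 -> NTlim (fun z => z ^+ n) zeta (zeta ^+ n).
Proof.
move=> z1; have := @poly_NTlim 'X^n zeta z1; rewrite hornerXn.
by rewrite (_ : horner _ = fun z => z ^+ n) //; apply/funext => z; rewrite hornerXn.
Qed.

(* On the unit circle this is [T g(z^(M+d))] with the Laurent polynomial
   [T = P / z^d] and [g w = - 2 w / (1 - w)], for which [Re g = 1]. *)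
Definition comb_term (P : {poly C}) (d M : nat) (z : C) : C :=
  - 2 * P.[z] * z ^+ M * (1 - z ^+ (M + d))^-1.

Lemma comb_term_NTlim P d M zeta : normc zeta = 1 -> zeta ^+ (M + d) != 1 ->
  NTlim (comb_term P d M) zeta (comb_term P d M zeta).
Proof.
move=> z1 zN; apply: NTlimM.
  by apply: NTlimM (NTlimX _ z1); apply: NTlimM (NTlim_cst _ _) (poly_NTlim _ z1).
apply: NTlimV; first by rewrite subr_eq0 eq_sym.
apply: NTlimD (NTlim_cst _ _) _.
have := NTlimM (NTlim_cst zeta (-1)) (NTlimX (M + d) z1).
by rewrite mulN1r (_ : (fun z => -1 * z ^+ (M + d)) = fun z => - z ^+ (M + d)) //;
  apply/funext => z; rewrite mulN1r.
Qed.

Lemma natr_le_exists (x : R) : exists n : nat, forall m, (n <= m)%N -> x <= m%:R.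
Proof.
exists (Num.truncn x).+1 => m nm; apply/ltW/(lt_le_trans (truncnS_gt _)).
by rewrite ler_nat.
Qed.

(** The factor [z^M] is small together with its slopes and remainders on the disc of radius [r],
    while the other factors keep bounds independent of [M]. *)
Lemma comb_term_quad P d r e : 0 <= r < 1 -> 0 < e ->
  exists M0, forall M, (M0 <= M)%N ->
    exists f', quad_control r e (comb_term P d M) f'.
Proof.
move=> r01 e0; have /andP[r0 r1] := r01.
have [a [a0 Ha]] := quad_control_poly P.
(* Each of the three products costs a factor 3. The number 7 bounds the constant of [quad_controlV]
   with [b = 2] and [t <= 1/2], that is [2 + 4 t + 8 t^2]. *)
pose t := Num.min (1/2) (e / (3 * (3 * (3 * (normc (- 2 : C) * a)) * 7) + 1)).
have nn : 0 <= 3 * (3 * (3 * (normc (- 2 : C) * a)) * 7).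
  by rewrite !mulr_ge0 // normc_ge0.
have t0 : 0 < t by rewrite lt_min !divr_gt0 // ltr_wpDl.
have th : t <= 1/2 by rewrite ge_min lexx.
have te : t * (3 * (3 * (3 * (normc (- 2 : C) * a)) * 7) + 1) <= e.
  by rewrite -ler_pdivlMr ?ltr_wpDl // ge_min lexx orbT.
have [M0 HM0] := natmul_pow_small r01 t0.
have QX n : (M0.+2 <= n)%N -> exists f', quad_control r t (fun z => z ^+ n) f'.
  case: n => [|[|n]] // Mn; exists (fun z => n.+2%:R * z ^+ n.+1).
  by apply: (quad_control_le (HM0 n Mn)); apply: quad_controlX; rewrite r0 ltW.
exists M0.+2 => M HM.
have [f1 H1] := QX M HM.
have [f2 H2] := QX (M + d)%N (leq_trans HM (leq_addr _ _)).
have small n z : (M0.+2 <= n)%N -> normc z <= r -> normc (z ^+ n) <= 1/2.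
  by move=> /QX[f' Hf'] zr; have [+ _ _ _] := Hf' z z zr zr => /le_trans; apply.
have away z : normc z <= r ->
    1 - z ^+ (M + d) != 0 /\ normc (1 - z ^+ (M + d))^-1 <= 2.
  move=> zr; have sz := small _ z (leq_trans HM (leq_addr d _)) zr.
  have lz : 1/2 <= normc (1 - z ^+ (M + d)).
    by have := normc_sub_le 1 (z ^+ (M + d)); rewrite normc1; lra.
  split; first by apply/eqP => E; move: lz; rewrite E normc0; lra.
  rewrite normcV invf_ple ?posrE //; lra.
have HV := quad_controlV H2 away.
have HP := quad_controlM (@quad_control_cst R r (- 2)) (quad_control_sub (ltW r1) Ha).
have HT := quad_controlM (quad_controlM HP H1) HV.
eexists; apply: quad_control_le HT.
apply: le_trans te.
have t2 : 2 + t * 2 ^+ 2 + t ^+ 2 * 2 ^+ 3 <= 7.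
  have : t * t <= t * (1/2) by rewrite ler_wpM2l // ltW.
  by rewrite !expr2 (exprS _ 2) expr2; nra.
move: nn; set q := 3 * (normc (- 2 : C) * a) => nn.
have q0 : 0 <= q by rewrite !mulr_ge0 // normc_ge0.
have : q * t * (2 + t * 2 ^+ 2 + t ^+ 2 * 2 ^+ 3) <= q * t * 7.
  by rewrite ler_wpM2l // mulr_ge0 // ltW.
move: (2 + _ + _) => s; have := mulr_ge0 q0 (ltW t0); lra.
Qed.

Lemma normcXB_le z w n : normc z <= 1 -> normc w <= 1 ->
  normc (z ^+ n - w ^+ n) <= n%:R * normc (z - w).
Proof.
move=> z1 w1; elim: n => [|n IH]; first by rewrite !expr0 subrr normc0 mul0r.
have -> : z ^+ n.+1 - w ^+ n.+1 = z * (z ^+ n - w ^+ n) + (z - w) * w ^+ n.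
  by rewrite !exprS; ring.
apply: (le_trans (ler_normcD _ _)); rewrite !normcM normcX -natr1 mulrDl mul1r.
apply: lerD.
  by apply: (le_trans _ IH); rewrite ler_piMl // normc_ge0.
by rewrite ler_piMr ?normc_ge0 // exprn_ile1 // normc_ge0.
Qed.

(* Either [1 - |z|] is so small that [z^n] is close to [zeta^n], or [|z|^n]
   stays away from 1; the bound is uniform in [n]. *)
Lemma cone_pow_away (A eta : R) n zeta z : 1 <= A -> 0 < eta <= 2 -> (0 < n)%N ->
  normc zeta = 1 -> cone A zeta z -> eta <= normc (1 - zeta ^+ n) ->
  eta / (4 * A) <= normc (1 - z ^+ n).
Proof.
move=> A1 /andP[e0 e2] n0 z1 [zd zc] ez.
have A0 : 0 < A by exact: lt_le_trans A1.
have [y [Ey y0 y1]] : exists y, [/\ eta = 4 * A * y, 0 < y & y <= 1 / 2].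
  exists (eta / (4 * A)); split; first by field; rewrite gt_eqF.
    by rewrite divr_gt0 // mulr_gt0.
  by rewrite ler_pdivrMr ?mulr_gt0 //; lra.
have -> : eta / (4 * A) = y by rewrite Ey mulrAC divff ?mul1r // gt_eqF // mulr_gt0.
have nR : (0 : R) < n%:R by rewrite ltr0n.
pose x := 1 - normc z.
have [H|H] := leP (n%:R * x) (2 * y).
  have E : normc (z ^+ n - zeta ^+ n) <= n%:R * normc (z - zeta).
    by apply: normcXB_le; rewrite ?z1 // ltW.
  have : normc (1 - zeta ^+ n) <= normc (1 - z ^+ n) + normc (z ^+ n - zeta ^+ n).
    have -> : 1 - zeta ^+ n = (1 - z ^+ n) + (z ^+ n - zeta ^+ n) by ring.
    exact: ler_normcD.
  have : n%:R * normc (z - zeta) <= n%:R * (A * x) by rewrite ler_wpM2l // ltW.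
  have : A * (n%:R * x) <= A * (2 * y) by rewrite ler_wpM2l // ltW.
  have : y <= A * y by rewrite ler_peMl // ltW.
  rewrite mulrCA; lra.
(* Now [n x > 2 y], so [bernoulli_inv] gives [1 - |z|^n >= 2 y / (1 + 2 y) >= y], the last
   inequality because [y <= 1/2]. *)
have Z := normc_ge0 z.
have := @bernoulli_inv R x n ltac:(by rewrite /x subr_ge0 (ltW zd) lerBlDr lerDl).
have -> : 1 - x = normc z by rewrite /x; ring.
have := normc_sub_le 1 (z ^+ n); rewrite normc1 normcX.
have : 0 <= normc z ^+ n by rewrite exprn_ge0.
move: (normc z ^+ n) => p p0 K1 K2.
have : p * (1 + 2 * y) <= 1 by apply: le_trans K2; rewrite ler_wpM2l // lerD2l ltW.
have : 0 <= y * (1 - p).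
  rewrite mulr_ge0 ?(ltW y0) // subr_ge0; apply: le_trans K2.
  by rewrite ler_peMr // lerDl mulr_ge0 // /x ?subr_ge0 ltW.
move: K1; nra.
Qed.

(** If [1 - |z| <= rho], the cone condition puts [z] within [A rho] of [zeta] and the Lipschitz
    bound applies; otherwise [|z|^M <= (1 - rho)^M] is negligible. The radius [rho] depends only on
    [P], [A] and [tau], whence the uniformity in [zeta]. *)
Lemma poly_cone_bound (P : {poly C}) (A tau : R) : 1 <= A -> 0 < tau ->
  exists M0, forall M, (M0 <= M)%N -> forall zeta z, normc zeta = 1 ->
    cone A zeta z -> normc (P.[z] * z ^+ M) <= normc P.[zeta] + tau.
Proof.
move=> A1 t0; have [a [a0 Ha]] := quad_control_poly P.
have A0 : 0 < A by exact: lt_le_trans A1.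
have b0 : 0 < a * A + tau + 1 by rewrite ltr_wpDl // addr_ge0 ?mulr_ge0 // ltW.
pose rho := tau / (a * A + tau + 1).
have r0 : 0 < rho by rewrite divr_gt0.
have r1 : rho <= 1.
  by rewrite ler_pdivrMr // mul1r; have := mulr_ge0 a0 (ltW A0); lra.
have Ea : rho * (a * A + tau + 1) = tau by rewrite divfK // gt_eqF.
have [M0 HM] := @pow_small R rho (tau / (a + 1)) ltac:(by rewrite r0)
   ltac:(by rewrite divr_gt0 // ltr_wpDl).
exists M0 => M /HM {}HM zeta z z1 [zd zc].
have Z := normc_ge0 z.
have [Pz _ L _] := Ha zeta z ltac:(by rewrite z1) (ltW zd).
have [Pz2 _ _ _] := Ha z z (ltW zd) (ltW zd).
rewrite normcM normcX.
have [H|H] := leP (1 - normc z) rho.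
  apply: (@le_trans _ _ (normc P.[z])).
    by rewrite ler_piMr ?normc_ge0 // exprn_ile1 // ltW.
  have : normc P.[z] <= normc P.[zeta] + normc (P.[z] - P.[zeta]).
    have {1}-> : P.[z] = P.[zeta] + (P.[z] - P.[zeta]) by ring.
    exact: ler_normcD.
  have : a * normc (z - zeta) <= a * (A * (1 - normc z)) by rewrite ler_wpM2l.
  have : a * A * (1 - normc z) <= a * A * rho by rewrite ler_wpM2l // mulr_ge0 // ltW.
  have : 0 <= rho * tau by rewrite mulr_ge0 // ltW.
  lra.
have zM : normc z ^+ M <= tau / (a + 1).
  by apply: le_trans HM; rewrite lerXn2r ?nnegrE ?subr_ge0 //; lra.
have : normc P.[z] * normc z ^+ M <= a * (tau / (a + 1)).
  by rewrite ler_pM ?normc_ge0 ?exprn_ge0.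
have : a * (tau / (a + 1)) <= tau.
  rewrite mulrA ler_pdivrMr ?ltr_wpDl //; lra.
have := normc_ge0 P.[zeta]; lra.
Qed.

Lemma cone_sub (A A' : R) zeta z : A <= A' -> cone A zeta z -> cone A' zeta z.
Proof.
move=> AA [z1 c]; split => //; apply: (le_trans c).
by rewrite ler_wpM2r // subr_ge0 ltW.
Qed.

(** A bound at the boundary point is carried to the whole cone: the numerator by [poly_cone_bound],
    the denominator by [cone_pow_away]. The constant is [2 * 4 A]. One [M0] serves all apertures up
    to [A0], so that successive stages can admit wider and wider cones. *)
Lemma comb_term_cone P d (A0 tau : R) : 1 <= A0 -> 0 < tau ->
  exists M0, forall M, (M0 <= M)%N -> forall A zeta z eta, 1 <= A <= A0 ->
    normc zeta = 1 -> cone A zeta z ->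
    0 < eta <= 2 -> eta <= normc (1 - zeta ^+ (M + d)) ->
    normc (comb_term P d M z) <= 8 * A * ((normc P.[zeta] + tau) / eta).
Proof.
move=> A01 t0; have [M0 HM] := poly_cone_bound P A01 t0.
exists M0.+1 => M MM A zeta z eta /andP[A1 AA] z1 cz e02 ez; have /andP[e0 _] := e02.
have A_gt0 : 0 < A by exact: lt_le_trans A1.
have n0 : (0 < M + d)%N by rewrite addn_gt0 (leq_trans _ MM).
have H1 := HM M (ltnW MM) zeta z z1 (cone_sub AA cz).
have H2 := cone_pow_away A1 e02 n0 z1 cz ez.
have y0 : 0 < eta / (4 * A) by rewrite divr_gt0 // mulr_gt0.
rewrite /comb_term -(mulrA (- 2)) !normcM normcV -normcM.
have -> : normc (- 2 : C) = 2.
  by rewrite normc_opp; have := normc_real (2 : R); rewrite rmorph_nat => ->; rewrite ger0_norm.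
rewrite ler_pdivrMr ?(lt_le_trans y0) //.
have q0 : 0 <= normc P.[zeta] + tau by rewrite addr_ge0 ?normc_ge0 // ltW.
apply: (@le_trans _ _ (8 * A * ((normc P.[zeta] + tau) / eta) * (eta / (4 * A)))).
  have -> : 8 * A * ((normc P.[zeta] + tau) / eta) * (eta / (4 * A)) =
    2 * (normc P.[zeta] + tau) by field; rewrite !gt_eqF.
  by rewrite ler_wpM2l.
by rewrite ler_wpM2l // !mulr_ge0 ?invr_ge0 // ltW.
Qed.

End Terms.

(** * Summation of the terms, and Stolz angles *)

Section SeriesOfTerms.
Variable R : realType.
Local Notation C := R[i].
Local Notation h k := ((2^-1 : R) ^+ k).
Implicit Types (z w zeta : C).

(** Here the constant may be large. It serves the finitely many terms of the series whose disc of
    smallness does not yet reach radius [r]. *)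
Lemma comb_term_quad_exists (P : {poly C}) d M r : (0 < M)%N -> 0 <= r < 1 ->
  exists a f', 0 <= a /\ quad_control r a (comb_term P d M) f'.
Proof.
move=> M0 /andP[r0 r1].
have [a [a0 Ha]] := quad_control_poly P.
have X n : exists a, 0 <= a /\ quad_control 1 a (fun z : C => z ^+ n) (horner ('X^n)^`()).
  have [b [b0 Hb]] := @quad_control_poly R 'X^n; exists b; split => //.
  by rewrite (_ : (fun z => _) = horner 'X^n) //; apply/funext => z; rewrite hornerXn.
have [b [b0 Hb]] := X M; have [c [c0 Hc]] := X (M + d)%N.
have s0 : 0 < 1 - r by rewrite subr_gt0.
have away z : normc z <= r ->
    1 - z ^+ (M + d) != 0 /\ normc (1 - z ^+ (M + d))^-1 <= (1 - r)^-1.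
  move=> zr.
  have sz : normc (z ^+ (M + d)) <= r.
    rewrite normcX; apply: (le_trans _ zr).
    have n0 : (0 < M + d)%N by rewrite addn_gt0 M0.
    rewrite -(prednK n0) exprS ler_piMr ?normc_ge0 // exprn_ile1 ?normc_ge0 //.
    exact: le_trans zr (ltW r1).
  have lz : 1 - r <= normc (1 - z ^+ (M + d)).
    by have := normc_sub_le 1 (z ^+ (M + d)); rewrite normc1; lra.
  split; first by apply/eqP => E; move: lz; rewrite E normc0 leNgt s0.
  by rewrite normcV lef_pV2 // posrE (lt_le_trans s0).
have HV := quad_controlV (quad_control_sub (ltW r1) Hc) away.
have HP := quad_controlM (@quad_control_cst R r (- 2)) (quad_control_sub (ltW r1) Ha).
have HT := quad_controlM (quad_controlM HP (quad_control_sub (ltW r1) Hb)) HV.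
do 2 eexists; split; last exact: HT.
by rewrite !mulr_ge0 ?normc_ge0 // !addr_ge0 ?mulr_ge0 ?exprn_ge0 ?invr_ge0 ?subr_ge0 ?(ltW r1) ?normc_ge0.
Qed.

Lemma quad_control_sum r (a : nat -> R) (B B' : nat -> C -> C) n :
  (forall k, quad_control r (a k) (B k) (B' k)) ->
  quad_control r (\sum_(0 <= k < n) a k) (fun z => \sum_(0 <= k < n) B k z)
    (fun z => \sum_(0 <= k < n) B' k z).
Proof.
move=> H; elim: n => [|n IH].
  by move=> z w _ _; rewrite !big_geq // subrr !mul0r subrr normc0.
rewrite big_nat_recr //=; have := quad_controlD IH (H n).
move=> + z w zr wr => /(_ z w zr wr); by rewrite !big_nat_recr.
Qed.

Lemma analytic_series (B : nat -> C -> C) :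
  (forall k r, 0 <= r < 1 -> exists a f', 0 <= a /\ quad_control r a (B k) f') ->
  (forall k, exists f', quad_control (1 - h k) (h k) (B k) f') ->
  exists f, analytic_on_disc f /\
    forall z, normc z < 1 -> ccvg (fun n => \sum_(0 <= k < n) B k z) (f z).
Proof.
move=> H1 H2.
(* The limit where one exists, and the default [0] elsewhere; only points of the disc matter. *)
pose f z := xget 0 [set l | ccvg (fun n => \sum_(0 <= k < n) B k z) l].
have Hf z : normc z < 1 -> ccvg (fun n => \sum_(0 <= k < n) B k z) (f z).
  move=> z1; have [K HK] := @half_pow_small R (1 - normc z) ltac:(by rewrite subr_gt0).
  have : exists l, ccvg (fun n => \sum_(0 <= k < n) B k z) l.
    apply: (@complex_series_half _ _ 1 K) => k Kk; have [f' Q] := H2 k.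
    have zk : normc z <= 1 - h k by have := HK k Kk; lra.
    by have [+ _ _ _] := Q z z zk zk; rewrite mul1r.
  by move=> [l Hl]; rewrite /f; case: xgetP => [_ -> //|/(_ l)]; case.
exists f; split => // z; rewrite /disc /= norm_normc -(rmorph1 (real_complex R)) ltcR => z1.
pose r := (1 + normc z) / 2; have Z := normc_ge0 z.
have zr : normc z < r by rewrite /r; lra.
have r0 : 0 <= r by rewrite /r; lra.
have r1 : r < 1 by rewrite /r; lra.
have [K HK] := @half_pow_small R (1 - r) ltac:(by rewrite subr_gt0).
have /choice[p Hp] : forall k, exists q : R * (C -> C),
    [/\ 0 <= q.1, quad_control r q.1 (B k) q.2 & (K <= k)%N -> q.1 = h k].
  move=> k.
  have [kK|Kk] := ltnP k K.
    have [a [f' [a0 Q]]] := H1 k r ltac:(by rewrite r0).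
    by exists (a, f'); split => //.
  have [f' Q] := H2 k; exists (h k, f'); split => //=.
  apply: quad_control_sub Q; have := HK k Kk; lra.
(* The constants from [K] on are [h k], and their sum is at most [2 * h K <= 2]; hence one constant
   controls all partial sums. *)
pose A := \sum_(0 <= k < K) (p k).1 + 2.
have A0 : 0 <= A by rewrite addr_ge0 // sumr_ge0 // => k _; have [] := Hp k.
have HA n : \sum_(0 <= k < n) (p k).1 <= A.
  have [nK|Kn] := leqP n K.
    rewrite /A (big_cat_nat (leq0n n) nK) /= -addrA lerDl addr_ge0 // sumr_ge0 // => k _.
    by have [] := Hp k.
  rewrite (big_cat_nat (leq0n K) (ltnW Kn)) /= lerD2l.
  rewrite (_ : \sum_(K <= k < n) (p k).1 = \sum_(K <= k < n) h k).
    rewrite (@geometric_half_sum R K n (ltnW Kn)); have := half_pow_le1 R K; have := half_pow_gt0 R n.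
    by move: (h K) (h n) => x y; lra.
  rewrite big_nat_cond [RHS]big_nat_cond; apply: eq_bigr => k.
  by rewrite andbT => /andP[Kk _]; have [_ _ ->] := Hp k.
have Q n : quad_control r A (fun z => \sum_(0 <= k < n) B k z)
    (fun z => \sum_(0 <= k < n) (p k).2 z).
  by apply: (quad_control_le (HA n)); apply: quad_control_sum => k; have [] := Hp k.
have [d Hd] : exists d, ccvg (fun n => \sum_(0 <= k < n) (p k).2 z) d.
  apply: (@complex_series_half _ _ 1 K) => k Kk; have [_ q /(_ Kk) E] := Hp k.
  by have [_ + _ _] := q z z (ltW zr) (ltW zr); rewrite E mul1r.
apply: (@taylor_derivable _ f z d r A A0 zr) => w wr.
have w1 : normc w < 1 by exact: le_lt_trans r1.
apply: (@ccvg_le _ (fun n => (\sum_(0 <= k < n) B k w + -1 * \sum_(0 <= k < n) B k z) +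
   - (w - z) * \sum_(0 <= k < n) (p k).2 z) _ _ 0).
  move=> n _; have [_ _ _] := Q n z w (ltW zr) wr.
  by rewrite mulN1r mulNr (mulrC (w - z)).
have -> : f w - f z - d * (w - z) = f w + -1 * f z + - (w - z) * d by ring.
by apply: ccvgD (ccvgZ _ Hd); apply: ccvgD (Hf _ w1) (ccvgZ _ (Hf _ z1)).
Qed.

(** Interchange of sum and limit: on each cone the tails are uniformly small, and the finite head
    has its limit term by term. The index from which the domination holds may depend on the
    aperture. *)
Lemma NTlim_series (B : nat -> C -> C) (f : C -> C) zeta (L : nat -> C) l :
  (forall k, NTlim (B k) zeta (L k)) ->
  (forall A, 1 <= A -> exists D K, 0 <= D /\
     forall k, (K <= k)%N -> forall z, cone A zeta z -> normc (B k z) <= D * h k) ->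
  (exists D K, 0 <= D /\ forall k, (K <= k)%N -> normc (L k) <= D * h k) ->
  ccvg (fun n => \sum_(0 <= k < n) L k) l ->
  (forall z, normc z < 1 -> ccvg (fun n => \sum_(0 <= k < n) B k z) (f z)) ->
  NTlim f zeta l.
Proof.
move=> H1 H2 [D2 [K2 [D20 HL]]] Hl Hf A e e0.
have [D1 [K1 [D10 HB]]] := H2 (Num.max 1 A) ltac:(by rewrite le_max lexx).
have [K3 HK3] := @half_pow_small R (e / (4 * D1 + 4 * D2 + 1)) ltac:(by rewrite divr_gt0 //; lra).
pose m := maxn K1 (maxn K2 K3).
have m1 : (K1 <= m)%N by rewrite leq_maxl.
have m2 : (K2 <= m)%N by rewrite /m maxnCA leq_maxl.
have m3 : (K3 <= m)%N by rewrite /m !leq_max leqnn !orbT.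
have hm := HK3 m m3; rewrite ler_pdivlMr in hm; last lra.
have [d [d0 Hd]] := @NTlim_sum R B zeta L m H1 A (e / 2) ltac:(by rewrite divr_gt0).
exists d; split => // z cz zd.
have z1 : normc z < 1 by case: cz.
have cz' : cone (Num.max 1 A) zeta z.
  by apply: cone_sub cz; rewrite le_max lexx orbT.
have E1 := ccvg_tail_half D10 (fun k Kk => HB k Kk z cz') m1 (Hf z z1).
have E2 := ccvg_tail_half D20 HL m2 Hl.
have E3 := Hd z cz zd.
have -> : f z - l = (f z - \sum_(0 <= k < m) B k z) +
  ((\sum_(0 <= k < m) B k z - \sum_(0 <= k < m) L k) - (l - \sum_(0 <= k < m) L k)) by ring.
apply: (le_trans (ler_normcD _ _)).
have := ler_normcB (\sum_(0 <= k < m) B k z - \sum_(0 <= k < m) L k) (l - \sum_(0 <= k < m) L k).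
have := half_pow_gt0 R m; move: (h m) hm E1 E2 E3 => x; lra.
Qed.

(** Every branch of [Arg] other than the one with positive real part yields an angle of modulus at
    least [pi / 2], except the default [Arg 0 = 0], which [w != 0] excludes. On the remaining branch
    [tan] is monotone. *)
Lemma stolz_Re_Im (theta : R) w : theta < pi / 2 -> w != 0 -> `|Arg w| < theta ->
  0 < complex.Re w /\ `|complex.Im w| <= `|tan theta| * complex.Re w.
Proof.
case: w => a b th w0; rewrite /Arg /=.
have atl := @atan_gtNpi2 R (b / a); have atr := @atan_ltpi2 R (b / a).
have P := @pi_gt0 R.
case: (ltrgtP 0 a) => a0.
- move=> H; split => //.
  have t0 : 0 <= theta by exact: le_trans (normr_ge0 _) (ltW H).
  have : `|b / a| <= tan theta.
    move: H; rewrite ltr_norml => /andP[h1 h2].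
    rewrite ler_norml -tanN -{1 2}(atanK (b / a)).
    apply/andP; split; apply: ltW; rewrite ltr_tan // in_itv /=; lra.
  rewrite normrM normfV (gtr0_norm a0) ler_pdivrMr // => /le_trans; apply.
  by rewrite ler_wpM2r ?ler_norm // ltW.
- case: ifP => b0; rewrite ltr_norml => /andP[h1 h2]; exfalso.
    suff : 0 <= atan (b / a) + pi / 2 by lra.
    lra.
  lra.
- case: (ltrgtP 0 b) => b0.
  + by rewrite ltr_norml => /andP[h1 h2]; exfalso; lra.
  + by rewrite normrN ltr_norml => /andP[h1 h2]; exfalso; lra.
  + by move: w0; rewrite -a0 -b0 eqxx.
Qed.

(* Near [zeta] a Stolz angle lies in a cone: with [w = 1 - conj zeta * z],
   [1 - |z|^2 = 2 Re w - |w|^2], and [|Im w| <= tan theta * Re w]. *)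
Lemma stolz_cone (theta : R) zeta z : theta < pi / 2 -> normc zeta = 1 ->
  stolz zeta theta z -> normc (z - zeta) < (1 + `|tan theta| ^+ 2)^-1 ->
  cone (2 * (1 + `|tan theta|)) zeta z.
Proof.
move=> th z1 []; rewrite norm_normc -(rmorph1 (real_complex R)) ltcR => zd.
rewrite rmorph1; set w := 1 - conjc zeta * z; set t := `|tan theta| => sz near.
have t0 : 0 <= t by rewrite normr_ge0.
have zz : conjc zeta * zeta = 1.
  have := normc_sqr zeta; rewrite z1 expr1n; case: (zeta) => a b /= E.
  by apply/eqP; rewrite eq_complex /=; apply/andP; split; apply/eqP; rewrite ?E; lra.
have nw : normc (z - zeta) = normc w.
  have -> : w = - (conjc zeta * (z - zeta)) by rewrite /w mulrBr zz; ring.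
  by rewrite normc_opp normcM normc_conj z1 mul1r.
have w0 : w != 0.
  apply/eqP => E; move: zd; suff -> : normc z = 1 by rewrite ltxx.
  have : normc (conjc zeta * z) = 1.
    have -> : conjc zeta * z = 1 - w by rewrite /w; ring.
    by rewrite E subr0 normc1.
  by rewrite normcM normc_conj z1 mul1r.
have [a0 bt] := stolz_Re_Im th w0 sz; rewrite -/t in bt.
have nz : normc z ^+ 2 = (1 - complex.Re w) ^+ 2 + complex.Im w ^+ 2.
  have -> : normc z = normc (1 - w).
    have -> : 1 - w = conjc zeta * z by rewrite /w; ring.
    by rewrite normcM normc_conj z1 mul1r.
  by rewrite normc_sqr; case: (w) => p q /=; rewrite sub0r sqrrN.
have aw : complex.Re w <= normc w by exact: le_trans (ler_norm _) (Re_le_normc w).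
have wab := normc_le_ReIm w; rewrite (gtr0_norm a0) in wab.
rewrite nw in near; split => //; rewrite nw.
have b2 : complex.Im w ^+ 2 <= t ^+ 2 * complex.Re w ^+ 2.
  rewrite -exprMn -(real_normK (num_real (complex.Im w))) lerXn2r ?nnegrE ?normr_ge0 //.
  by rewrite mulr_ge0 // ltW.
have s0 : 0 < 1 + t ^+ 2 by rewrite ltr_pwDl // exprn_ge0.
have at1 : complex.Re w * (1 + t ^+ 2) <= 1.
  by rewrite -ler_pdivlMr // mul1r; apply: ltW; exact: le_lt_trans near.
move: a0 aw wab b2 at1 nz bt; move: (complex.Re w) (complex.Im w) => a b a0 aw wab b2 at1 nz bt.
have Z := normc_ge0 z.
(* Closeness to [zeta] gives [|w|^2 <= (1 + t^2) a^2 <= a], so that [2 a - |w|^2 >= a]. *)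
have K1 : a <= 1 - normc z ^+ 2.
  have : a * (a * (1 + t ^+ 2)) <= a * 1 by rewrite ler_wpM2l // ltW.
  rewrite nz; nra.
have K2 : 1 - normc z ^+ 2 <= 2 * (1 - normc z).
  move: (normc z) Z => n n0; have := sqr_ge0 (n - 1); rewrite !expr2; lra.
have : normc w <= (1 + t) * a by rewrite mulrDl mul1r; lra.
move/le_trans; apply; rewrite -mulrA mulrCA ler_wpM2l ?addr_ge0 //; lra.
Qed.

Lemma NTlim_path (f : C -> C) zeta L gamma : normc zeta = 1 ->
  nontangential_path zeta gamma -> NTlim f zeta L ->
  forall e, 0 < e -> \forall s \near (1 : R)^'-, normc (f (gamma s) - L) <= e.
Proof.
move=> z1 [gd [_ [gz [theta [th gs]]]]] Hf e e0.
have [d [d0 Hd]] := Hf (2 * (1 + `|tan theta|)) e e0.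
have s0 : 0 < (1 + `|tan theta| ^+ 2)^-1 by rewrite invr_gt0 ltr_pwDl // exprn_ge0.
have m0 : 0 < Num.min d (1 + `|tan theta| ^+ 2)^-1 by rewrite lt_min d0.
near=> s.
have : `|zeta - gamma s| < ((Num.min d (1 + `|tan theta| ^+ 2)^-1)%:C)%C.
  by near: s; move/cvgrPdist_lt : gz; apply; rewrite ltcR.
rewrite norm_normc ltcR normcB lt_min => /andP[n1 n2].
apply: Hd => //; apply: stolz_cone => //.
by near: s.
Unshelve. all: by end_near. Qed.

Lemma NTlim_path_Re (f : C -> C) zeta L gamma c : normc zeta = 1 ->
  nontangential_path zeta gamma -> NTlim f zeta L ->
  (fun s : R => complex.Re (c * f (gamma s))) @ (1 : R)^'- --> complex.Re (c * L).
Proof.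
move=> z1 ng Hf; apply/cvgrPdist_le => e e0.
have e1 : 0 < e / (normc c + 1) by rewrite divr_gt0 // ltr_wpDl // normc_ge0.
near=> s.
have : normc (f (gamma s) - L) <= e / (normc c + 1) by near: s; exact: (NTlim_path z1 ng Hf).
rewrite ler_pdivlMr ?ltr_wpDl ?normc_ge0 // => H.
have -> : complex.Re (c * L) - complex.Re (c * f (gamma s)) = complex.Re (c * (L - f (gamma s))).
  by rewrite mulrBr Re_add; case: (c * f (gamma s)).
apply: (le_trans (Re_le_normc _)); rewrite normcM normcB.
have := normc_ge0 (f (gamma s) - L); lra.
Unshelve. all: by end_near. Qed.

End SeriesOfTerms.

(** * Approximation in measure by Laurent polynomials *)

Section Mostly.
Variable R : realType.
Local Notation C := R[i].
Local Notation lom := ((@wlength R idfun)^*%mu).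
Local Notation h k := ((2^-1 : R) ^+ k).

Lemma lom_itv (a b : R) : a <= b -> lom `[a, b]%classic = (b - a)%:E.
Proof.
rewrite le_eqVlt => /predU1P[->|ab].
  by have := @lebesgue_measure_itv R (`[b, b])%R; rewrite /= ltxx subrr => E; exact: E.
by have := @lebesgue_measure_itv R (`[a, b])%R; rewrite /= lte_fin ab => E; exact: E.
Qed.

(** Outer measure is used because predicates such as the existence of a nontangential limit come
    with no proof of measurability. The window is one period of [expi]; [mostly 0] means almost
    everywhere on it. *)
Definition mostly (e : R) (P : R -> Prop) : Prop :=
  (lom [set t | (- pi <= t <= pi)%R /\ ~ P t] <= e%:E)%E.

Lemma mostly_imp e (P Q : R -> Prop) :
  (forall t, - pi <= t <= pi -> P t -> Q t) -> mostly e P -> mostly e Q.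
Proof.
move=> PQ; apply: le_trans; apply: le_outer_measure => t [tW nQ]; split => // Pt.
by apply: nQ; apply: PQ.
Qed.

Lemma mostly_le e e' P : e <= e' -> mostly e P -> mostly e' P.
Proof. by move=> ee H; apply: (le_trans H); rewrite lee_fin. Qed.

Lemma mostly_and e e' P Q : mostly e P -> mostly e' Q ->
  mostly (e + e') (fun t => P t /\ Q t).
Proof.
move=> HP HQ; rewrite /mostly EFinD; apply: le_trans (leeD HP HQ).
apply: le_trans (outer_measureU2 _ _ _); apply: le_outer_measure => t [tW nPQ] /=.
have [Pt|] := pselect (P t); last by left.
by right; split => // Qt; apply: nPQ.
Qed.

Lemma mostly_all e (P : R -> Prop) : 0 <= e ->
  (forall t, - pi <= t <= pi -> P t) -> mostly e P.
Proof.
move=> e0 H; apply: (@le_trans _ _ 0%E); last by rewrite lee_fin.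
rewrite -(outer_measure0 lom); apply: le_outer_measure => t [tW]; apply.
exact: H.
Qed.

Lemma mostly_away (x s e : R) : 0 <= s -> 2 * s <= e -> mostly e (fun t => s <= `|t - x|).
Proof.
move=> s0 se; apply: (@le_trans _ _ (lom `[x - s, x + s]%classic)).
  apply: le_outer_measure => t [_ /negP]; rewrite -ltNge ltr_norml => /andP[? ?] /=.
  rewrite in_itv /=; lra.
by rewrite lom_itv ?lee_fin; lra.
Qed.

Definition laurent (T : R -> C) : Prop :=
  exists (P : {poly C}) d, forall t, T t = P.[expi t] / expi t ^+ d.

Lemma laurent_cst c : laurent (fun=> c).
Proof. by exists c%:P, 0%N => t; rewrite hornerC expr0 divr1. Qed.

Lemma laurent_expi : laurent (@expi R).
Proof. by exists 'X, 0%N => t; rewrite hornerX expr0 divr1. Qed.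

Lemma laurent_expiV : laurent (fun t => (@expi R t)^-1).
Proof. by exists 1, 1%N => t; rewrite hornerC expr1 mul1r. Qed.

Lemma laurentD S T : laurent S -> laurent T -> laurent (fun t => S t + T t).
Proof.
move=> [P [d HP]] [Q [d' HQ]]; exists (P * 'X^d' + Q * 'X^d), (d + d')%N => t.
have := expf_neq0 d (expi_neq0 t); have := expf_neq0 d' (expi_neq0 t).
rewrite HP HQ !(hornerD, hornerM, hornerXn) exprD.
move: (expi t ^+ d) (expi t ^+ d') => x y x0 y0; field; exact/andP.
Qed.

Lemma laurentM S T : laurent S -> laurent T -> laurent (fun t => S t * T t).
Proof.
move=> [P [d HP]] [Q [d' HQ]]; exists (P * Q), (d + d')%N => t.
have := expf_neq0 d (expi_neq0 t); have := expf_neq0 d' (expi_neq0 t).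
rewrite HP HQ !(hornerD, hornerM, hornerXn) exprD.
move: (expi t ^+ d) (expi t ^+ d') => x y x0 y0; field; exact/andP.
Qed.

Lemma laurentX T n : laurent T -> laurent (fun t => T t ^+ n).
Proof.
move=> HT; elim: n => [|n IH].
  by rewrite (_ : (fun t => _) = fun=> 1); [exact: laurent_cst|apply/funext => t].
rewrite (_ : (fun t => _) = fun t => T t * T t ^+ n); first exact: laurentM.
by apply/funext => t; rewrite exprS.
Qed.

Lemma laurent_cos m : laurent (fun t : R => ((cos (t - m))%:C)%C).
Proof.
have := laurentM (laurent_cst (2^-1)) (laurentD (laurentM laurent_expi (laurent_cst (expi (- m))))
  (laurentM laurent_expiV (laurent_cst (expi m)))).
set S := (fun t => _); suff -> : S = fun t : R => ((cos (t - m))%:C)%C by [].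
apply/funext => t; rewrite /S -expiD.
have -> : (expi t)^-1 = expi (- t).
  by apply: (mulfI (expi_neq0 t)); rewrite mulfV ?expi_neq0 // -expiD subrr expi0.
rewrite -expiD (_ : - t + m = - (t - m)); last by ring.
rewrite /expi cosN sinN.
apply: (mulfI (x := 2)); first by rewrite pnatr_eq0.
rewrite mulrA divff ?pnatr_eq0 // mul1r mulr_natl.
by apply/eqP; rewrite mulr2n eq_complex /= subrr addr0 !eqxx.
Qed.

(** Closure of the Laurent polynomials for convergence in measure, in the Ky Fan form: one [e]
    bounds both the error and the exceptional set. *)
Definition approximable (F : R -> C) : Prop :=
  forall e, 0 < e -> exists T, laurent T /\ mostly e (fun t => normc (F t - T t) <= e).

Lemma approximable_closed F :
  (forall e, 0 < e -> exists G, approximable G /\ mostly e (fun t => normc (F t - G t) <= e)) ->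
  approximable F.
Proof.
move=> H e e0; have e2 : 0 < e / 2 by rewrite divr_gt0.
have [G [/(_ _ e2) [T [LT HT]] HG]] := H _ e2; exists T; split => //.
rewrite (splitr e); apply: mostly_imp (mostly_and HG HT) => t _ [a b].
rewrite -splitr (_ : F t - T t = (F t - G t) + (G t - T t)); last by ring.
by apply: (le_trans (ler_normcD _ _)); lra.
Qed.

Lemma approximable_laurent T : laurent T -> approximable T.
Proof.
move=> LT e e0; exists T; split => //; apply: mostly_all; first exact: ltW.
by move=> t _; rewrite subrr normc0 ltW.
Qed.

Lemma approximableD F G : approximable F -> approximable G ->
  approximable (fun t => F t + G t).
Proof.
move=> HF HG e e0; have e2 : 0 < e / 2 by rewrite divr_gt0.
have [S [LS HS]] := HF _ e2; have [T [LT HT]] := HG _ e2.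
exists (fun t => S t + T t); split; first exact: laurentD.
rewrite (splitr e); apply: mostly_imp (mostly_and HS HT) => t _ [a b].
rewrite -splitr (_ : F t + G t - (S t + T t) = (F t - S t) + (G t - T t)); last by ring.
by apply: (le_trans (ler_normcD _ _)); lra.
Qed.

Lemma approximableZ c F : approximable F -> approximable (fun t => c * F t).
Proof.
move=> HF e e0; have c0 := normc_ge0 c.
pose t := Num.min e (e / (normc c + 1)).
have t0 : 0 < t by rewrite lt_min e0 divr_gt0 // ltr_wpDl.
have te : t <= e by rewrite ge_min lexx.
have tc : t * (normc c + 1) <= e by rewrite -ler_pdivlMr ?ltr_wpDl // ge_min lexx orbT.
have [S [LS HS]] := HF _ t0; exists (fun t => c * S t); split.
  exact: laurentM (laurent_cst c) LS.
apply: (mostly_le te); apply: mostly_imp HS => x _ H.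
rewrite -mulrBr normcM; apply: le_trans tc.
by have := ler_wpM2l c0 H; lra.
Qed.

Lemma approximableM F G : (forall t, normc (F t) <= 1) -> (forall t, normc (G t) <= 1) ->
  approximable F -> approximable G -> approximable (fun t => F t * G t).
Proof.
move=> F1 G1 HF HG e e0.
(* The approximant [T] of [G] satisfies only [|T| <= 1 + s <= 2], so the product error is at most
   [s + 2 s]. *)
pose s := Num.min 1 (e / 3).
have s0 : 0 < s by rewrite lt_min ltr01 divr_gt0.
have s1 : s <= 1 by rewrite ge_min lexx.
have se : s <= e / 3 by rewrite ge_min lexx orbT.
have [S [LS HS]] := HF _ s0; have [T [LT HT]] := HG _ s0.
exists (fun t => S t * T t); split; first exact: laurentM.
apply: (@mostly_le (s + s)); first lra.
apply: mostly_imp (mostly_and HS HT) => t _ [a b].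
rewrite (_ : F t * G t - S t * T t = F t * (G t - T t) + (G t - (G t - T t)) * (F t - S t)); last by ring.
apply: (le_trans (ler_normcD _ _)); rewrite !normcM.
have c : normc (G t - (G t - T t)) <= 2.
  by apply: (le_trans (ler_normcB _ _)); have := G1 t; lra.
have := ler_pM (normc_ge0 _) (normc_ge0 _) (F1 t) b.
have := ler_pM (normc_ge0 _) (normc_ge0 _) c a.
lra.
Qed.

Definition ind (E : set R) (t : R) : C := (`[< E t >])%:R.

Lemma normc_ind E t : normc (ind E t) <= 1.
Proof. by rewrite /ind; case: asboolP => _; rewrite ?normc0 ?normc1. Qed.

(* [(1 - p^n)^K] with [K] about [c^-n] separates [p < c] from [c < p]. *)
Lemma threshold_poly (c d e : R) : 0 < c <= 1 -> 0 < d -> 0 < e ->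
  exists n K : nat, forall p : R, 0 <= p <= 1 ->
    [/\ 0 <= (1 - p ^+ n) ^+ K <= 1,
        p <= c - d -> 1 - (1 - p ^+ n) ^+ K <= e &
        c + d <= p -> (1 - p ^+ n) ^+ K <= e].
Proof.
move=> /andP[c0 c1] d0' e0.
pose d1 := Num.min d c.
have d0 : 0 < d1 by rewrite lt_min d0'.
have dd : d1 <= d by rewrite ge_min lexx.
have dc : d1 <= c by rewrite ge_min lexx orbT.
have [N1 H1] := @pow_small R (d1 / c) (e / 2)
  ltac:(by rewrite divr_gt0 //= ler_pdivrMr // mul1r) ltac:(by rewrite divr_gt0).
have [N2 H2] := @pow_small R (d1 / (c + d1)) e
  ltac:(by rewrite divr_gt0 ?addr_gt0 //= ler_pdivrMr ?addr_gt0 // mul1r lerDr ltW) e0.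
pose n := maxn N1 N2; have {}H1 := H1 n (leq_maxl _ _); have {}H2 := H2 n (leq_maxr _ _).
have cn0 : 0 < c ^+ n by rewrite exprn_gt0.
have cn1 : c ^+ n <= 1 by rewrite exprn_ile1 // ltW.
(* This gives [1 <= K c^n <= 2]. Then [K p^n] is at most [2 (p / c)^n], small for [p <= c - d], and
   at least [(p / c)^n], large for [p >= c + d]; Bernoulli's inequality from below and
   [bernoulli_inv] conclude. *)
pose K := (Num.truncn (c ^+ n)^-1).+1.
have K1 : 1 <= c ^+ n * K%:R.
  by rewrite -ler_pdivrMl // mulr1; apply/ltW/truncnS_gt.
have K2 : K%:R * c ^+ n <= 2.
  have : (Num.truncn (c ^+ n)^-1)%:R <= (c ^+ n)^-1 by rewrite truncn_le // invr_ge0 ltW.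
  rewrite -(ler_pM2r cn0) mulVf ?gt_eqF // /K -natr1 mulrDl mul1r; lra.
exists n, K => p /andP[p0 p1].
have pn0 : 0 <= p ^+ n by rewrite exprn_ge0.
have pn1 : p ^+ n <= 1 by rewrite exprn_ile1.
have q0 : 0 <= 1 - p ^+ n by rewrite subr_ge0.
have q1 : 1 - p ^+ n <= 1 by rewrite lerBlDr lerDl.
split; first by rewrite exprn_ge0 // exprn_ile1.
- move=> pc.
  have B : forall k, 1 - k%:R * p ^+ n <= (1 - p ^+ n) ^+ k.
    elim=> [|k IH]; first by rewrite mul0r subr0.
    rewrite exprSr -natr1; have := ler_wpM2r q0 IH.
    have : 0 <= k%:R * (p ^+ n * p ^+ n) by rewrite !mulr_ge0.
    lra.
  have pe : p ^+ n <= c ^+ n * (e / 2).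
    apply: le_trans (ler_wpM2l (ltW cn0) H1); rewrite -exprMn lerXn2r ?nnegrE //.
      by rewrite mulrBr mulr1 mulrCA divff ?gt_eqF // mulr1 subr_ge0.
    rewrite mulrBr mulr1 mulrCA divff ?gt_eqF // mulr1; lra.
  have : K%:R * p ^+ n <= K%:R * (c ^+ n * (e / 2)) by rewrite ler_wpM2l.
  have : K%:R * c ^+ n * (e / 2) <= 2 * (e / 2) by rewrite ler_wpM2r // divr_ge0 // ltW.
  have := B K; lra.
- move=> cp; have := @bernoulli_inv R (p ^+ n) K ltac:(by rewrite pn0).
  have Q : 0 <= (1 - p ^+ n) ^+ K by rewrite exprn_ge0.
  have cd : 0 < c + d1 by rewrite addr_gt0.
  have E : c = (c + d1) * (1 - d1 / (c + d1)) by field; rewrite gt_eqF.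
  have P : c ^+ n <= p ^+ n * e.
    rewrite {1}E exprMn ler_pM ?exprn_ge0 ?(ltW cd) //.
      by rewrite -(pmulr_rge0 _ cd) -E ltW.
    by rewrite lerXn2r ?nnegrE ?(ltW cd) //; lra.
  move: ((1 - p ^+ n) ^+ K) Q => q Q Hq.
  have : 0 <= q * K%:R * (p ^+ n * e - c ^+ n) by rewrite mulr_ge0 ?mulr_ge0 ?subr_ge0.
  have : 0 <= q * (c ^+ n * K%:R - 1) by rewrite mulr_ge0 // subr_ge0.
  have : 0 <= e * (1 - q * (1 + K%:R * p ^+ n)) by rewrite mulr_ge0 ?subr_ge0 // ltW.
  have := mulr_ge0 (ltW e0) Q; lra.
Qed.

Lemma sin_away (s x : R) : 0 <= s <= pi / 2 -> s <= x <= pi - s -> sin s <= sin x.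
Proof.
move=> /andP[s0 s1] /andP[x0 x1]; have P := @pi_gt0 R.
have [H|H] := leP x (pi / 2).
  by rewrite leNgt ltr_sin ?in_itv /= -?leNgt //; lra.
have -> : sin x = sin (pi - x) by rewrite sinB sinpi cospi mul0r sub0r mulN1r opprK.
by rewrite leNgt ltr_sin ?in_itv /= -?leNgt //; lra.
Qed.

(** The trigonometric polynomial [p], equal to the square of [sin ((t - m) / 2)], lies below its
    endpoint value [c] inside the interval and is at least [c] on the rest of the window. The
    polynomial of [threshold_poly] at level [c] turns it into an approximate indicator, and the
    factorisation [pq] measures the distance from the level. *)
Lemma approximable_itv (a b : R) : - pi <= a -> a < b -> b <= pi ->
  approximable (ind [set t | a < t < b]).
Proof.
move=> pa ab bp e e0; have P := @pi_gt0 R.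
pose s := Num.min (e / 8) (pi / 2).
have s0 : 0 < s by rewrite lt_min !divr_gt0.
have se : s <= e / 8 by rewrite ge_min lexx.
have sp : s <= pi / 2 by rewrite ge_min lexx orbT.
have sn0 : 0 < sin (s / 2) by apply: sin_gt0_pi; lra.
pose m := (a + b) / 2; pose l := (b - a) / 2.
pose c := (1 - cos l) / 2.
have c0 : 0 < c.
  rewrite divr_gt0 // subr_gt0 -cos0 ltr_cos ?in_itv /= /l; lra.
have c1 : c <= 1 by rewrite /c; have := @cos_geN1 R l; lra.
pose p t : R := (1 - cos (t - m)) / 2.
have p01 t : 0 <= p t <= 1.
  by rewrite /p; have := @cos_geN1 R (t - m); have := @cos_le1 R (t - m); lra.
have pq t : p t = c - sin ((t - a) / 2) * sin ((b - t) / 2).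
  rewrite /p /c; have -> : t - m = (t - a) / 2 - (b - t) / 2 by rewrite /m; field.
  have -> : l = (t - a) / 2 + (b - t) / 2 by rewrite /l; field.
  by rewrite cosB cosD; field.
have [n [K HnK]] := @threshold_poly c (sin (s / 2) * sin (s / 2)) e
  ltac:(by rewrite c0) ltac:(by rewrite mulr_gt0) e0.
exists (fun t : R => (((1 - p t ^+ n) ^+ K)%:C)%C); split.
  rewrite (_ : (fun t => _) = fun t => (1 + -1 * (2^-1 * (1 + -1 * ((cos (t - m))%:C)%C)) ^+ n) ^+ K).
    apply/laurentX/laurentD; first exact: laurent_cst.
    apply: laurentM (laurent_cst _) (laurentX _ _).
    apply: laurentM (laurent_cst _) (laurentD (laurent_cst _) _).
    exact: laurentM (laurent_cst _) (laurent_cos _).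
  apply/funext => t; rewrite rmorphXn rmorphB rmorph1 rmorphXn /p.
  rewrite rmorphM rmorphB rmorph1 fmorphV rmorph_nat !mulN1r.
  by rewrite (mulrC _ 2^-1).
(* The product in [pq] vanishes at [a] and [b], and also at [pi] when [a = - pi] and at [- pi] when
   [b = pi]. Four neighbourhoods of measure [2 s <= e / 4] are therefore removed. *)
have away x : mostly (2 * s) (fun t => s <= `|t - x|) by apply: mostly_away (ltW s0) (lexx _).
apply: (@mostly_le (2 * s + (2 * s + (2 * s + 2 * s)))); first lra.
apply: mostly_imp (mostly_and (away a) (mostly_and (away b) (mostly_and (away pi) (away (- pi))))).
move=> t tW [ta [tb [tp tn]]]; have [/andP[B0 B1] Hlo Hhi] := HnK (p t) (p01 t).
have lb x : s / 2 <= x <= pi - s / 2 -> sin (s / 2) <= sin x.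
  by move=> H; apply: sin_away => //; lra.
have {}tp : t <= pi - s by move: tp; rewrite distrC ger0_norm; lra.
have {}tn : - pi + s <= t by move: tn; rewrite ger0_norm; lra.
rewrite /ind; case: asboolP.
  move=> /andP[t1 t2].
  have {}ta : a + s <= t by move: ta; rewrite gtr0_norm; lra.
  have {}tb : t <= b - s by move: tb; rewrite ltr0_norm; lra.
  have -> : true%:R - ((1 - p t ^+ n) ^+ K)%:C%C = ((1 - (1 - p t ^+ n) ^+ K)%:C)%C.
    by rewrite [RHS]rmorphB rmorph1.
  rewrite normc_real ger0_norm ?subr_ge0 //.
  apply: Hlo; rewrite pq lerB // ler_pM ?(ltW sn0) // lb //; lra.
move=> tI; rewrite sub0r normc_opp normc_real ger0_norm //; apply: Hhi.
rewrite pq lerD2l.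
have [t1|t1] := leP t a.
  have {}ta : t <= a - s by move: ta; rewrite ler0_norm; lra.
  rewrite -mulNr -sinN; apply: ler_pM; rewrite ?(ltW sn0) //; apply: lb; lra.
have t2 : b <= t by rewrite leNgt; apply/negP => tb'; apply: tI; rewrite /= t1.
have {}tb : b + s <= t by move: tb; rewrite ger0_norm; lra.
rewrite -mulrN -sinN; apply: ler_pM; rewrite ?(ltW sn0) //; apply: lb; lra.
Qed.

End Mostly.

(** * Measurable functions are approximable *)

Section MeasurableApproximation.
Variable R : realType.
Local Notation C := R[i].
Local Notation lom := ((@wlength R idfun)^*%mu).
Local Notation h k := ((2^-1 : R) ^+ k).
Local Notation LM := (lom.-cara.-measurable).

Lemma ereal_cvg0_le (u : nat -> \bar R) (e : R) : u @ \oo --> 0%E -> 0 < e ->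
  exists N, (u N <= e%:E)%E.
Proof.
move=> /fine_cvgP[fin /cvgrPdist_le/(_ e) H] /H{}H.
have [N _ /(_ N (leqnn N))[fu]] := filterI fin H.
move=> /=; rewrite sub0r normrN => fe; exists N.
by rewrite -(fineK fu) lee_fin (le_trans (ler_norm _)).
Qed.

Lemma approximable_ext (F G : R -> C) :
  (forall e, 0 < e -> mostly e (fun t => F t = G t)) -> approximable G -> approximable F.
Proof.
move=> H HG; apply: approximable_closed => e e0; exists G; split => //.
by apply: mostly_imp (H e e0) => t _ ->; rewrite subrr normc0 ltW.
Qed.

Lemma approximable_cst (c : C) : approximable (fun=> c).
Proof. exact/approximable_laurent/laurent_cst. Qed.

Lemma approximable_oo (x y : R) : approximable (ind `]x, y[).
Proof.
pose a := Num.max x (- pi); pose b := Num.min y pi.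
have P := @pi_gt0 R.
have in_ab t : - pi < t < pi -> (x < t < y) = (a < t < b).
  by move=> /andP[t1 t2]; rewrite /a /b gt_max lt_min t1 t2 !andbT.
have E G : (forall t, - pi < t < pi -> ind `]x, y[ t = G t) -> approximable G ->
    approximable (ind `]x, y[).
  move=> H; apply: approximable_ext => e e0; have e8 : 0 < e / 8 by rewrite divr_gt0.
  have A z : mostly (2 * (e / 8)) (fun t => e / 8 <= `|t - z|) by apply: mostly_away (ltW e8) (lexx _).
  apply: (@mostly_le _ (2 * (e / 8) + 2 * (e / 8))); first lra.
  apply: mostly_imp (mostly_and (A pi) (A (- pi))) => t /andP[t1 t2] [n1 n2].
  apply: H; rewrite !lt_neqAle t1 t2 !andbT; apply/andP; split; apply/eqP => tE.
    by move: n2; rewrite -tE subrr normr0; lra.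
  by move: n1; rewrite tE subrr normr0; lra.
have [ab|ba] := ltP a b.
  apply: (E (ind [set t | a < t < b])).
    by move=> t tp; rewrite /ind; congr (_ %:R); congr (nat_of_bool _);
      apply: asbool_equiv_eq; rewrite /= in_itv /= in_ab.
  by apply: approximable_itv; rewrite // /a /b ?le_max ?ge_min ?lexx ?orbT.
apply: (E (fun=> 0)); last exact: approximable_cst.
move=> t tp; rewrite /ind; case: asboolP => //=; rewrite in_itv /= in_ab // => /andP[t1 t2].
by have := lt_trans t1 t2; rewrite ltNge ba.
Qed.

Lemma approximableU (E F : set R) : approximable (ind E) -> approximable (ind F) ->
  approximable (ind (E `|` F)).
Proof.
move=> HE HF.
have -> : ind (E `|` F) = (fun t => (ind E t + ind F t) + -1 * (ind E t * ind F t)).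
  apply/funext => t; rewrite /ind asbool_or.
  by case: asboolP => _; case: asboolP => _ /=; ring.
apply: approximableD; first exact: approximableD.
apply: approximableZ; apply: approximableM => // t; exact: normc_ind.
Qed.

Lemma lom_oo (F : set R) : is_open_itv F -> lom F = wlength idfun F.
Proof.
by move=> [[a b] ->] /=; rewrite wlength_itv -(@lebesgue_measure_itv R (`]a, b[)%R).
Qed.

(** Littlewood's first principle: within the window, [E] differs from a finite union of open
    intervals by a set of small measure. Half of [e] pays for the excess of an open cover over [E],
    half for the discarded tail of the cover. *)
Lemma approximable_set (E : set R) : LM E -> approximable (ind E).
Proof.
move=> mE; apply: approximable_closed => e e0.
have e2 : 0 < e / 2 by rewrite divr_gt0.
have P := @pi_gt0 R.
pose A := [set t | (- pi <= t <= pi)%R /\ E t].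
have Afin : lom A \is a fin_num.
  rewrite ge0_fin_numE ?outer_measure_ge0 //.
  apply: (@le_lt_trans _ _ (lom `[- pi, pi]%classic)).
    by apply: le_outer_measure => t [tW _]; rewrite /= in_itv.
  by rewrite lom_itv ?ltry //; lra.
have [F [Fi AF] FA] : exists2 F, open_itv_cover A F &
    (\sum_(0 <= k <oo) lom (F k) <= lom A + (e / 2)%:E)%E.
  have := Afin; rewrite outer_measure_open_itv_cover.
  move=> /lb_ereal_inf_adherent-/(_ _ e2)[_/= [F]] AF <- Fe.
  exists F => //; apply: le_trans (ltW Fe); apply: lee_nneseries => // k _.
    by rewrite outer_measure_ge0.
  by rewrite lom_oo //; case: AF.
pose X := \bigcup_k F k.
(* Carathéodory's condition for [E], tested on [X], splits the measure of [X]; the part inside [E]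
   has at least the measure of [A], which is finite and can be cancelled. *)
have HX : (lom (X `&` ~` E) <= (e / 2)%:E)%E.
  rewrite -(leeD2lE _ _ Afin); apply: le_trans FA.
  apply: le_trans (outer_measure_sigma_subadditive lom F).
  rewrite -/X (mE X); apply: leeD => //; apply: le_outer_measure => t [tW Et].
  by split => //; apply: AF.
have [N HN] : exists N, (\sum_(N <= k <oo) lom (F k) <= (e / 2)%:E)%E.
  apply: (@ereal_cvg0_le (fun N => \sum_(N <= k <oo) lom (F k))%E) => //.
  apply: nneseries_tail_cvg => [|k _]; last exact: outer_measure_ge0.
  by apply: (le_lt_trans FA); rewrite -(fineK Afin) -EFinD ltry.
exists (ind (\big[setU/set0]_(k < N) F k)); split.
  elim/big_ind : _ => [|S T|k _].
  - have -> : ind set0 = fun=> (0 : C).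
      by apply/funext => t; rewrite /ind; case: asboolP.
    exact: approximable_cst.
  - exact: approximableU.
  - by have [[a b] ->] := Fi k; exact: approximable_oo.
rewrite /mostly (splitr e) EFinD.
apply: le_trans (leeD HX (le_trans (outer_measure_sigma_subadditive_tail lom N F) HN)).
apply: le_trans (outer_measureU2 _ _ _); apply: le_outer_measure => t [tW].
rewrite -splitr => H; have [Et|nEt] := pselect (E t).
  right; have [k _ Fk] := AF t (conj tW Et); exists k => //= kN.
  apply: H; rewrite /ind asboolT // asboolT ?subrr ?normc0 ?ltW //.
  by rewrite -bigcup_mkord; exists k.
left; split => //; apply: contrapT => nX; apply: H.
rewrite /ind asboolF // asboolF ?subrr ?normc0 ?ltW //.
by rewrite -bigcup_mkord => -[k _ Fk]; apply: nX; exists k.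
Qed.

Lemma Lmeasurable_ge (F : R -> R) c : Lmeasurable_fun F -> LM [set t | c <= F t].
Proof.
move=> mF; have := mF measurableT _ (measurable_itv (`[c, +oo[)%R); rewrite setTI.
by congr (LM _); apply/seteqP; split => t /=; rewrite in_itv /= andbT.
Qed.

(* Binary expansion of a function with values in [0, 1]. *)
Lemma approximable_unit n (F : R -> R) : Lmeasurable_fun F ->
  (forall t, 0 <= F t <= 1) ->
  exists G, approximable G /\ forall t, normc ((F t)%:C%C - G t) <= h n.
Proof.
elim: n F => [|n IH] F mF F01.
  exists (fun=> 0); split; first exact: approximable_cst.
  by move=> t; rewrite subr0 normc_real expr0 ger0_norm; have := F01 t; lra.
pose E := [set t | 2^-1 <= F t].
have mE : LM E by exact: Lmeasurable_ge.
have [G [HG FG]] := IH (fun t => 2 * F t - \1_E t) ltac:(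
  by apply: measurable_funB; [apply: measurable_funM => //; exact: measurable_cst|
     exact: measurable_indic])
  ltac:(by move=> t; have := F01 t; rewrite indicE; case: (boolP (t \in E));
     rewrite /E ?notin_setE ?in_setE /=; lra).
exists (fun t => 2^-1 * ind E t + 2^-1 * G t); split.
  by apply: approximableD; apply: approximableZ => //; exact: approximable_set.
move=> t; have := FG t; rewrite exprS.
have -> : (F t)%:C%C - (2^-1 * ind E t + 2^-1 * G t) =
    (2^-1)%:C%C * ((2 * F t - \1_E t)%:C%C - G t).
  rewrite indicE rmorphB rmorphM fmorphV /ind.
  have -> : `[< E t >] = (t \in E) by apply/asboolP/idP => [/mem_set|/set_mem].
  by rewrite !rmorph_nat; field.
by rewrite normcM normc_real ger0_norm ?invr_ge0 // => H; rewrite ler_wpM2l ?invr_ge0.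
Qed.

Lemma approximable_bounded (F : R -> R) (M : R) : 0 < M -> Lmeasurable_fun F ->
  (forall t, `|F t| <= M) -> approximable (fun t => (F t)%:C%C).
Proof.
move=> M0 mF FM.
pose G t := (F t + M) / (2 * M).
have HG : approximable (fun t => (G t)%:C%C).
  apply: approximable_closed => e e0; have [n /(_ n (leqnn n)) Hn] := half_pow_small e0.
  have [H [aH GH]] := @approximable_unit n G ltac:(
     by apply: measurable_funM; [apply: measurable_funD => //|]; exact: measurable_cst)
   ltac:(by move=> t; have := FM t; rewrite ler_norml /G => /andP[? ?];
     rewrite divr_ge0 ?ler_pdivrMr ?mul1r ?mulr_ge0 ?mulr_gt0 ?(ltW M0) //; lra).
  exists H; split => //; apply: mostly_all; first exact: ltW.
  by move=> t _; apply: le_trans Hn.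
have -> : (fun t => (F t)%:C%C) = (fun t => (2 * M)%:C%C * (G t)%:C%C + (- M)%:C%C).
  apply/funext => t; rewrite -rmorphM -rmorphD; congr (_%:C%C).
  by rewrite /G; field; rewrite gt_eqF.
by apply: approximableD; [exact: approximableZ|exact: approximable_cst].
Qed.

Lemma LM_window : LM `[- pi, pi]%classic.
Proof. by apply: sub_caratheodory; exact: measurable_itv. Qed.

(** The sets where [|F| >= n] decrease to the empty set inside a window of finite measure, so
    continuity from above applies. Writing [n.+1] keeps the bound positive. *)
Lemma mostly_bounded (F : R -> R) e : Lmeasurable_fun F -> 0 < e ->
  exists n : nat, mostly e (fun t => `|F t| <= n.+1%:R).
Proof.
move=> mF e0; have P := @pi_gt0 R.
pose G n := `[- pi, pi]%classic `&` [set t : R | n%:R <= `|F t|].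
have mabs : Lmeasurable_fun (fun t => `|F t|) by apply: measurableT_comp.
have mG n : LM (G n).
  by apply: (@measurableI _ (caratheodory_type lom)); [exact: LM_window|exact: Lmeasurable_ge].
have G0 : \bigcap_n G n = set0.
  apply/seteqP; split => // t Ht.
  have [n /(_ n (leqnn n)) Hn] : exists n : nat, forall m, (n <= m)%N -> `|F t| + 1 <= m%:R.
    exists (Num.truncn (`|F t| + 1)).+1 => m nm; apply/ltW/(lt_le_trans (truncnS_gt _)).
    by rewrite ler_nat.
  by have [_ /=] := Ht n I; lra.
have cvg : (lom \o G) @ \oo --> lom (\bigcap_n G n).
  apply: (@nonincreasing_cvg_mu _ _ _ (@completed_lebesgue_measure R) G).
  - apply: (@le_lt_trans _ _ (lom `[- pi, pi]%classic)).
      by apply: le_outer_measure => t [].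
    by rewrite lom_itv ?ltry //; lra.
  - exact: mG.
  - by rewrite G0; exact: measurable0.
  - move=> n m nm; apply/subsetPset => t [tW /= H]; split => //=.
    by apply: le_trans H; rewrite ler_nat.
rewrite G0 outer_measure0 in cvg.
have [N HN] := ereal_cvg0_le cvg e0; exists N; apply: le_trans HN.
apply: le_outer_measure => t [tW /negP]; rewrite -ltNge => H; split; first by rewrite /= in_itv.
by rewrite /=; apply: le_trans (ltW H); rewrite ler_nat.
Qed.

Lemma approximable_real (F : R -> R) : Lmeasurable_fun F -> approximable (fun t => (F t)%:C%C).
Proof.
move=> mF; apply: approximable_closed => e e0; have [n Hn] := mostly_bounded mF e0.
pose M : R := n.+1%:R; have M0 : 0 < M by rewrite ltr0n.
pose G t := Num.max (- M) (Num.min (F t) M).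
exists (fun t => (G t)%:C%C); split.
  apply: (@approximable_bounded G M M0).
    by apply: measurable_maxr; [|apply: measurable_minr => //]; exact: measurable_cst.
  move=> t; rewrite ler_norml /G le_max lexx /= ge_max ge_min lexx orbT andbT; lra.
apply: mostly_imp Hn => t _; rewrite -/M ler_norml => /andP[a b].
by rewrite /G (min_idPl b) (max_idPr a) subrr normc0 ltW.
Qed.

(** * Measurable complex-valued functions and their algebra *)

Definition cmeasurable (F : R -> C) : Prop :=
  Lmeasurable_fun (fun t => complex.Re (F t)) /\ Lmeasurable_fun (fun t => complex.Im (F t)).

Lemma approximable_measurable (F : R -> C) : cmeasurable F -> approximable F.
Proof.
move=> [mR mI].
have -> : F = (fun t => (complex.Re (F t))%:C%C + 'i%C * (complex.Im (F t))%:C%C).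
  by apply/funext => t; exact: complexE.
by apply: approximableD; [|apply: approximableZ]; exact: approximable_real.
Qed.

Lemma cmeasurable_cst c : cmeasurable (fun=> c).
Proof. by split; exact: measurable_cst. Qed.

Lemma cmeasurable_real (F : R -> R) : Lmeasurable_fun F -> cmeasurable (fun t => (F t)%:C%C).
Proof. by move=> mF; split => //=; exact: measurable_cst. Qed.

Lemma cmeasurableD F G : cmeasurable F -> cmeasurable G -> cmeasurable (fun t => F t + G t).
Proof.
move=> [a b] [c d]; split.
  by rewrite (_ : (fun t => _) = (fun t => complex.Re (F t) + complex.Re (G t)));
    [exact: measurable_funD|apply/funext => t; rewrite Re_add].
by rewrite (_ : (fun t => _) = (fun t => complex.Im (F t) + complex.Im (G t)));
  [exact: measurable_funD|apply/funext => t; rewrite Im_add].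
Qed.

Lemma cmeasurableM F G : cmeasurable F -> cmeasurable G -> cmeasurable (fun t => F t * G t).
Proof.
move=> [a b] [c d]; split.
  rewrite (_ : (fun t => _) = (fun t => complex.Re (F t) * complex.Re (G t)
    - complex.Im (F t) * complex.Im (G t))).
    by apply: measurable_funB; apply: measurable_funM.
  by apply/funext => t; case: (F t) (G t) => ? ? [].
rewrite (_ : (fun t => _) = (fun t => complex.Re (F t) * complex.Im (G t)
    + complex.Im (F t) * complex.Re (G t))).
  by apply: measurable_funD; apply: measurable_funM.
by apply/funext => t; case: (F t) (G t) => ? ? [].
Qed.

Lemma cmeasurable_conj F : cmeasurable F -> cmeasurable (fun t => conjc (F t)).
Proof.
move=> [a b]; split.
  by rewrite (_ : (fun t => _) = (fun t => complex.Re (F t))) //; apply/funext => t; case: (F t).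
rewrite (_ : (fun t => _) = (fun t => - complex.Im (F t))); first exact: measurable_funN.
by apply/funext => t; case: (F t).
Qed.

Lemma Lmeasurable_borel (F : R -> R) : measurable_fun setT F -> Lmeasurable_fun F.
Proof.
by move=> mF _ Y mY; apply: sub_caratheodory; have := mF measurableT Y mY.
Qed.

Lemma cmeasurable_expi : cmeasurable (@expi R).
Proof.
split; apply: Lmeasurable_borel; apply: continuous_measurable_fun => t.
  exact: continuous_cos.
exact: continuous_sin.
Qed.

Lemma cmeasurableX F n : cmeasurable F -> cmeasurable (fun t => F t ^+ n).
Proof.
move=> mF; elim: n => [|n IH]; first exact: cmeasurable_cst.
rewrite (_ : (fun t => _) = fun t => F t * F t ^+ n); first exact: cmeasurableM.
by apply/funext => t; rewrite exprS.
Qed.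

Lemma cmeasurable_poly (P : {poly C}) F : cmeasurable F -> cmeasurable (fun t => P.[F t]).
Proof.
move=> mF; elim/poly_ind: P => [|P c IH].
  by rewrite (_ : (fun t => _) = fun=> 0); [exact: cmeasurable_cst|apply/funext => t; rewrite horner0].
rewrite (_ : (fun t => _) = fun t => P.[F t] * F t + c).
  by apply: cmeasurableD (cmeasurable_cst _); exact: cmeasurableM.
by apply/funext => t; rewrite !hornerE.
Qed.

Lemma Lmeasurable_inv (F : R -> R) : (forall t, 0 <= F t) ->
  Lmeasurable_fun F -> Lmeasurable_fun (fun t => (F t)^-1).
Proof.
move=> F0 mF; rewrite (_ : (fun t => _) = (fun x => x `^ (-1)) \o F).
  by apply: measurableT_comp => //; exact: measurable_powR.
by apply/funext => t /=; rewrite powR_inv1.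
Qed.

Lemma cmeasurableV F : cmeasurable F -> cmeasurable (fun t => (F t)^-1).
Proof.
move=> mF.
rewrite (_ : (fun t => _) = fun t =>
    ((complex.Re (F t * conjc (F t)))^-1)%:C%C * conjc (F t)).
  apply: cmeasurableM (cmeasurable_conj mF); apply: cmeasurable_real.
  apply: Lmeasurable_inv.
    by move=> t; case: (F t) => a b /=; rewrite mulrN opprK addr_ge0 // -expr2 sqr_ge0.
  exact: (cmeasurableM mF (cmeasurable_conj mF)).1.
apply/funext => t; case: (F t) => a b /=.
have -> : a * a - b * - b = a ^+ 2 + b ^+ 2 by ring.
apply/eqP; rewrite eq_complex /=; move: (_^-1) => q.
by apply/andP; split; apply/eqP; ring.
Qed.

End MeasurableApproximation.

(** * Exceptional sets *)

Section NullSets.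
Variable R : realType.
Local Notation C := R[i].
Local Notation lom := ((@wlength R idfun)^*%mu).
Local Notation h k := ((2^-1 : R) ^+ k).

Lemma expi_2pi n : expi (n%:R * (pi *+ 2) : R) = 1.
Proof. by rewrite -expiX /expi cos2pi sin2pi expr1n. Qed.

Lemma lom_bigsetU_le (F : nat -> set R) n (c : R) :
  (forall k, (k < n)%N -> (lom (F k) <= c%:E)%E) ->
  (lom (\big[setU/set0]_(k < n) F k) <= (n%:R * c)%:E)%E.
Proof.
move=> H; apply: (le_trans (outer_measure_subadditive lom F n)).
apply: (@le_trans _ _ (\sum_(k < n) c%:E)%E).
  by apply: lee_sum => k _; exact: H.
by rewrite sumEFin lee_fin sumr_const card_ord mulr_natl.
Qed.

(* The bound does not depend on the frequency [N]: the exceptional set is a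
   comb of about [N] intervals of length [2 d / N]. *)
Lemma comb_mostly (d : R) N : 0 < d <= pi -> (0 < N)%N ->
  mostly (6 * d) (fun t : R => 1 - cos d <= normc (1 - expi t ^+ N)).
Proof.
move=> /andP[d0 dp] N0; have P := @pi_gt0 R.
have NR : (1 : R) <= N%:R by rewrite ler1n.
have NR0 : (0 : R) < N%:R by rewrite ltr0n.
(* Angles of the [N]-th roots of unity, shifted by [N] so that a natural index also reaches the
   negative ones. The [2 N + 1] intervals have total length [(2 N + 1) * 2 d / N <= 6 d]. *)
pose c k : R := (k%:R - N%:R) * (pi *+ 2) / N%:R.
pose F k : set R := `[c k - d / N%:R, c k + d / N%:R]%classic.
have dN : 0 < d / N%:R by rewrite divr_gt0.
apply: (@le_trans _ _ ((2 * N).+1%:R * (2 * (d / N%:R)))%:E); last first.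
  rewrite lee_fin -natr1 natrM.
  have E : d = N%:R * (d / N%:R) by rewrite mulrC divfK // gt_eqF.
  rewrite [X in _ <= 6 * X]E; move: dN; move: (d / N%:R) => x x0.
  move: NR; move: (N%:R : R) => y y1.
  have : x <= y * x by rewrite ler_peMl // ltW.
  lra.
apply: (@le_trans _ _ (lom (\big[setU/set0]_(k < (2 * N).+1) F k))); last first.
  apply: lom_bigsetU_le => k _; rewrite /F; move: (c k) (d / N%:R) dN => x y y0.
  by rewrite lom_itv ?lee_fin; lra.
apply: le_outer_measure => t [/andP[t1 t2] /negP]; rewrite -ltNge => H.
(* This is [N t / (2 pi) + 1/2 + N]: truncating it rounds to the nearest root of unity, and the
   summand [N] makes it nonnegative. *)
pose y := (N%:R * t + pi + N%:R * (pi *+ 2)) / (pi *+ 2).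
have q0 : 0 < pi *+ 2 :> R by rewrite pmulrn_lgt0.
have Nt1 : - (N%:R * pi) <= N%:R * t by rewrite -mulrN ler_pM2l.
have Nt2 : N%:R * t <= N%:R * pi by rewrite ler_pM2l.
have Np : pi <= N%:R * pi :> R by rewrite ler_peMl // ltW.
have y0 : 0 <= y by rewrite divr_ge0 ?(ltW q0) // mulr2n; lra.
pose k := Num.truncn y.
have /andP[k1 k2] : k%:R <= y < k.+1%:R by rewrite truncn_itv.
rewrite ler_pdivlMr // in k1; rewrite ltr_pdivrMr // -natr1 in k2.
pose s := N%:R * t + N%:R * (pi *+ 2) - k%:R * (pi *+ 2).
have s1 : - pi <= s by rewrite /s; lra.
have s2 : s <= pi by move: k2; rewrite /s mulrDl mul1r mulr2n; lra.
have kN : (k < (2 * N).+1)%N.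
  rewrite ltnS -(ler_nat R) natrM -(ler_pM2r q0).
  apply: (le_trans k1); rewrite mulr2n; lra.
have Es : expi t ^+ N = expi s.
  rewrite expiX; apply: (mulIf (expi_neq0 (k%:R * (pi *+ 2)))).
  rewrite -(expiD s) /s subrK expi_2pi mulr1 expiD expi_2pi mulr1 //.
have cs : cos d < cos s.
  have := Re_le_normc (1 - expi s); rewrite -Es => /le_lt_trans/(_ H).
  rewrite Es /= => /(le_lt_trans (ler_norm _)); lra.
have sd : `|s| < d.
  rewrite -ltr_cos ?in_itv /=.
  - by have [s0|s0] := ger0P s; rewrite ?cosN.
  - by rewrite normr_ge0 /= ler_norml s1 s2.
  - by rewrite (ltW d0) dp.
rewrite -bigcup_mkord; exists k => //=.
have Et : t = c k + s / N%:R by rewrite /c /s; field; rewrite gt_eqF.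
have : `|s / N%:R| < d / N%:R.
  by rewrite normrM normfV (gtr0_norm NR0) ltr_pM2r ?invr_gt0.
rewrite ltr_norml => /andP[q1 q2]; rewrite /F /= in_itv /=; move: q1 q2 Et; move: (c k) (s / _) (d / _) => x1 x2 x3; lra.
Qed.

Lemma comb_null N : (0 < N)%N -> mostly 0 (fun t : R => expi t ^+ N != 1).
Proof.
move=> N0; have P := @pi_gt0 R; apply/lee_addgt0Pr => e e0; rewrite add0e.
pose d := Num.min (e / 6) pi.
have d0 : 0 < d by rewrite lt_min divr_gt0.
have dp : d <= pi by rewrite ge_min lexx orbT.
have de : d <= e / 6 by rewrite ge_min lexx.
have := @comb_mostly d N ltac:(by rewrite d0) N0.
have : 6 * d <= e by lra.
move=> /mostly_le H /H; apply: mostly_imp => t _; apply: contraTneq => ->.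
rewrite subrr normc0 -ltNge subr_gt0 -cos0 ltr_cos ?in_itv //=; lra.
Qed.

Lemma mostly_borel_cantelli (D : R) (P : nat -> R -> Prop) : 0 <= D ->
  (forall k, mostly (D * h k) (P k)) ->
  mostly 0 (fun t => exists K, forall k, (K <= k)%N -> P k t).
Proof.
move=> D0 H; apply/lee_addgt0Pr => e e0; rewrite add0e.
have [K /(_ K (leqnn K)) HK] := @half_pow_small R (e / (2 * D + 1)) ltac:(by rewrite divr_gt0 //; lra).
have {}HK : 2 * D * h K <= e.
  by move: HK; rewrite ler_pdivlMr; have := half_pow_gt0 R K; lra.
pose F k := [set t | (- pi <= t <= pi)%R /\ ~ P k t].
apply: (@le_trans _ _ (lom (\bigcup_(k in ~` `I_K) F k))).
  apply: le_outer_measure => t [tW] /forallNP/(_ K)/existsNP[k /not_implyP[Kk nP]].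
  by exists k => //=; apply/negP; rewrite -leqNgt.
apply: (le_trans (outer_measure_sigma_subadditive_tail lom K F)).
apply: lime_le.
  by apply: is_cvg_nneseries => n _ _; exact: outer_measure_ge0.
apply: nearW => n; apply: (@le_trans _ _ (\sum_(K <= k < n) (D * h k)%:E)%E).
  by apply: lee_sum => k _; exact: H.
rewrite sumEFin lee_fin -mulr_sumr; apply: le_trans HK.
have [Kn|nK] := leqP K n.
  by rewrite geometric_half_sum // mulrBr; have := mulr_ge0 D0 (ltW (half_pow_gt0 R n)); lra.
rewrite (big_geq (ltnW nK)) mulr0; apply: mulr_ge0; first by rewrite mulr_ge0.
exact: ltW (half_pow_gt0 R K).
Qed.

Lemma mostly0_and (P Q : R -> Prop) : mostly 0 P -> mostly 0 Q -> mostly 0 (fun t => P t /\ Q t).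
Proof. by move=> HP HQ; have := mostly_and HP HQ; rewrite addr0. Qed.

Lemma lom0_bigcup (F : nat -> set R) : (forall k, (lom (F k) <= 0)%E) ->
  (lom (\bigcup_k F k) <= 0)%E.
Proof.
move=> H; apply: (le_trans (outer_measure_sigma_subadditive lom F)).
by rewrite eseries0 // => k _ _; apply/eqP; rewrite eq_le H outer_measure_ge0.
Qed.

Lemma mostly0_all (P : nat -> R -> Prop) : (forall k, mostly 0 (P k)) ->
  mostly 0 (fun t => forall k, P k t).
Proof.
move=> H; have := lom0_bigcup H; apply: le_trans; apply: le_outer_measure.
by move=> t [tW /existsNP[k nP]]; exists k.
Qed.

Lemma lom_shift_le (A : set R) (c : R) : (lom [set t | A (t - c)%R] <= lom A)%E.
Proof.
rewrite [leRHS]outer_measure_open_itv_cover; apply: le_ereal_inf_tmp => _ /= [F [Fi AF] <-].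
rewrite outer_measure_open_itv_cover; apply: ereal_inf_lbound => /=.
exists (fun k => [set t | F k (t - c)]).
  split=> [k|t /AF[k _ Fk]]; last by exists k.
  have [[a b] -> /=] := Fi k; exists (a + c, b + c) => /=.
  by apply/seteqP; split => t /=; rewrite !in_itv /= ltrBrDr ltrBlDr.
apply: eq_eseriesr => k _; have [[a b] -> /=] := Fi k.
rewrite (_ : [set t | _] = `]a + c, b + c[%classic).
  rewrite !wlength_itv /= !lte_fin ltrD2r; case: ifP => // _.
  by rewrite -!EFinD; congr (_%:E); ring.
by apply/seteqP; split => t /=; rewrite !in_itv /= ltrBrDr ltrBlDr.
Qed.

(** Translates of one period cover the line and the outer measure does not grow under translation.
    There are two families of translates because the shifts are indexed by natural numbers. *)
Lemma ae_periodic (P : C -> Prop) : mostly 0 (fun t => P (expi t)) ->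
  {ae (@completed_lebesgue_measure R), forall t, P (expi t)}.
Proof.
move=> H; have p0 := @pi_gt0 R.
pose A := [set t : R | (- pi <= t <= pi)%R /\ ~ P (expi t)].
pose F n := [set t : R | A (t - n%:R * (pi *+ 2))].
pose G n := [set t : R | A (t - - (n%:R * (pi *+ 2)))].
have q0 : 0 < pi *+ 2 :> R by rewrite pmulrn_lgt0.
have F0 : (lom (\bigcup_n F n) <= 0)%E.
  by apply: lom0_bigcup => k; exact: le_trans (lom_shift_le _ _) H.
have G0 : (lom (\bigcup_n G n) <= 0)%E.
  by apply: lom0_bigcup => k; exact: le_trans (lom_shift_le _ _) H.
have N0 : lom [set t | ~ P (expi t)] = 0%E.
  apply/eqP; rewrite eq_le outer_measure_ge0 andbT -[0%E]adde0.
  apply: le_trans (leeD F0 G0); apply: le_trans (outer_measureU2 _ _ _).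
  apply: le_outer_measure => t nP.
  have tr (x : R) : - pi <= x -> exists n : nat, - pi <= x - n%:R * (pi *+ 2) <= pi.
    move=> xp; exists (Num.truncn ((x + pi) / (pi *+ 2))).
    have : 0 <= (x + pi) / (pi *+ 2) by rewrite divr_ge0 ?(ltW q0) //; lra.
    move/truncn_itv => /andP[]; rewrite ler_pdivlMr // ltr_pdivrMr // -natr1 => k1 k2.
    by apply/andP; split; move: k1 k2; rewrite ?mulrDl ?mul1r ?mulr2n; lra.
  have [tp|tp] := leP (- pi) t.
    have [n Hn] := tr t tp; left; exists n => //; split => //.
    rewrite (_ : expi _ = expi t) //.
    by rewrite -[in RHS](subrK (n%:R * (pi *+ 2)) t) [in RHS]expiD expi_2pi mulr1.
  have [n Hn] := tr (- t) ltac:(lra); right; exists n => //; split.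
    by move: Hn => /andP[a b]; apply/andP; split; lra.
  by rewrite opprK expiD expi_2pi mulr1.
have [B [mB B0 NB]] := (negligible_outer_measure [set t | ~ P (expi t)]).2 N0.
exists B; split => //; exact: sub_caratheodory.
Qed.

End NullSets.

(** * The boundary value problem *)

Section Construction.
Variable R : realType.
Local Notation C := R[i].
Local Notation h k := ((2^-1 : R) ^+ k).

(** The lower bound of [comb_mostly] for [d = h k]; off the comb it gives [|g| <= 2 / gap k]. *)
Definition gap k : R := 1 - cos (h k).
(** The factor [gap k] pays for the multiplication by [g] at stage [k]. The factor [gap k.+1] pays
    in advance for the next stage, whose polynomial is about as large as the residual that stage [k]
    leaves. *)
Definition tol k : R := h k * (gap k * gap k.+1).

Lemma gap_gt0 k : 0 < gap k.
Proof.
have := half_pow_gt0 R k; have := half_pow_le1 R k; have := @pi_ge2 R.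
rewrite /gap subr_gt0; move: (h k) => x ? ? ?.
by rewrite -(@cos0 R) ltr_cos ?in_itv /=; lra.
Qed.

Lemma gap_le1 k : gap k <= 1.
Proof.
have := half_pow_gt0 R k; have := half_pow_le1 R k; have := @pi_ge2 R.
rewrite /gap lerBlDr lerDl; move: (h k) => x ? ? ?.
by apply: cos_ge0_pihalf; lra.
Qed.

Lemma tol_gt0 k : 0 < tol k.
Proof. by rewrite !mulr_gt0 ?gap_gt0 // half_pow_gt0. Qed.

(* What the [k]-th term of the series must satisfy when [u] is the part of the
   boundary data that the previous terms have left over. *)
Definition stage (Lam : R -> C) k (u : R -> R) (p : {poly C} * nat * nat) : Prop :=
  let: (P, d, M) := p in
  [/\ (0 < M)%N,
   mostly (h k) (fun t => normc (Lam t * (u t)%:C%C - P.[expi t] / expi t ^+ d) <= tol k),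
   exists f', quad_control (1 - h k) (h k) (comb_term P d M) f' &
   forall A zeta z eta, 1 <= A <= k.+1%:R -> normc zeta = 1 -> cone A zeta z ->
     0 < eta <= 2 -> eta <= normc (1 - zeta ^+ (M + d)) ->
    normc (comb_term P d M z) <= 8 * A * ((normc P.[zeta] + tol k) / eta)].

(** [P] and [d] come first, from the approximation in measure; both thresholds for [M] depend on
    them. The [1] in the maximum makes the term vanish at the origin. *)
Lemma stage_exists (Lam : R -> C) (k : nat) (u : R -> R) :
  cmeasurable Lam -> Lmeasurable_fun u -> exists p, stage Lam k u p.
Proof.
move=> mL mp.
have hk := half_pow_gt0 R k.
have e0 : 0 < Num.min (h k) (tol k) by rewrite lt_min hk tol_gt0.
have [T [[P [d PT]] HT]] := approximable_measurable (cmeasurableM mL (cmeasurable_real mp)) e0.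
have r01 : 0 <= 1 - h k < 1.
  by have := half_pow_le1 R k; move: (h k) hk => x *; lra.
have [M1 H1] := comb_term_quad P d r01 hk.
have [M2 H2] := @comb_term_cone R P d k.+1%:R (tol k) ltac:(by rewrite ler1n) (tol_gt0 k).
exists (P, d, maxn 1 (maxn M1 M2)); split.
- by rewrite leq_max.
- apply: (@mostly_le _ (Num.min (h k) (tol k))); first by rewrite ge_min lexx.
  apply: mostly_imp HT => t _; rewrite PT => /le_trans; apply.
  by rewrite ge_min lexx orbT.
- by apply: H1; rewrite !leq_max leqnn !orbT.
- by apply: H2; rewrite !leq_max leqnn !orbT.
Qed.

Lemma comb_term_laurent (P : {poly C}) d M (t : R) :
  comb_term P d M (expi t) =
  P.[expi t] / expi t ^+ d * (- 2 * expi t ^+ (M + d) / (1 - expi t ^+ (M + d))).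
Proof.
rewrite /comb_term exprD; have := expf_neq0 d (expi_neq0 t).
move: (_ - _)^-1 => q; move: (expi t ^+ d) => x x0; by field.
Qed.

Lemma Re_comb (w : C) : normc w = 1 -> w != 1 -> complex.Re (- 2 * w / (1 - w)) = 1.
Proof.
move=> w1 nw; have := normc_sqr w; rewrite w1 expr1n => E.
have -> : - 2 * w / (1 - w) = (- 2 * w * conjc (1 - w)) / ((1 - w) * conjc (1 - w)).
  have n1 : 1 - w != 0 by rewrite subr_eq0 eq_sym.
  have n2 : conjc (1 - w) != 0 by rewrite conjc_eq0.
  by move: (conjc _) n2 => v v0; field; rewrite n1 v0.
have -> : (1 - w) * conjc (1 - w) = (2 - 2 * complex.Re w)%:C%C.
  case: w E {w1 nw} => a b /= E; apply/eqP; rewrite eq_complex /=.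
  by apply/andP; split; apply/eqP; lra.
have -> : - 2 * w * conjc (1 - w) = Complex (2 - 2 * complex.Re w) (- 2 * complex.Im w).
  case: w E {w1 nw} => a b /= E; apply/eqP; rewrite eq_complex /=.
  by apply/andP; split; apply/eqP; lra.
have q0 : 2 - 2 * complex.Re w != 0.
  apply: contra nw => /eqP H; rewrite eq_complex /=.
  have H1 : complex.Re w = 1 by lra.
  rewrite H1 expr1n in E; have : complex.Im w ^+ 2 = 0 by lra.
  by move=> /eqP; rewrite sqrf_eq0 H1 => /eqP ->; rewrite !eqxx.
rewrite -fmorphV; move: (2 - _) q0 => q q0 /=; rewrite mulr0 subr0 divff //.
Qed.

Variables (Lam : R -> C) (phi : R -> R).
Hypothesis Lam1 : forall t, normc (Lam t) = 1.
Hypothesis mLam : cmeasurable Lam.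
Hypothesis mphi : Lmeasurable_fun phi.

Lemma comb_term_measurable (P : {poly C}) d M : cmeasurable (fun t : R => comb_term P d M (expi t)).
Proof.
have mz := @cmeasurable_expi R.
apply: cmeasurableM.
  apply: cmeasurableM (cmeasurableX _ mz).
  exact: cmeasurableM (cmeasurable_cst _) (cmeasurable_poly _ mz).
apply: cmeasurableV; apply: cmeasurableD (cmeasurable_cst _) _.
rewrite (_ : (fun t => _) = fun t => -1 * expi t ^+ (M + d)).
  exact: cmeasurableM (cmeasurable_cst _) (cmeasurableX _ mz).
by apply/funext => t; rewrite mulN1r.
Qed.

Lemma stages_exist : exists (r : nat -> R -> R) (P : nat -> {poly C}) (d M : nat -> nat),
  [/\ r 0%N = phi, forall k, stage Lam k (r k) (P k, d k, M k) &
   forall k t, r k.+1 t =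
     r k t - complex.Re (conjc (Lam t) * comb_term (P k) (d k) (M k) (expi t))].
Proof.
(* A choice is made for every pair of an index and a function, with a dummy value for nonmeasurable
   data. The recursion can then be defined first and its measurability proved afterwards. *)
have /choice[S HS] : forall q : nat * (R -> R), exists p,
    Lmeasurable_fun q.2 -> stage Lam q.1 q.2 p.
  move=> [k u]; have [mu|] := pselect (Lmeasurable_fun u); last by exists (0, 0%N, 0%N).
  by have [p Hp] := stage_exists k mLam mu; exists p.
pose next k u := fun t => u t - complex.Re (conjc (Lam t) *
   comb_term (S (k, u)).1.1 (S (k, u)).1.2 (S (k, u)).2 (expi t)).
pose r := fix r k := if k is k'.+1 then next k' (r k') else phi.
have mr k : Lmeasurable_fun (r k).
  elim: k => [|k IH]; first exact: mphi.
  apply: measurable_funB; first exact: IH.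
  suff : cmeasurable (fun t => conjc (Lam t) * comb_term (S (k, r k)).1.1
    (S (k, r k)).1.2 (S (k, r k)).2 (expi t)) by case.
  exact: cmeasurableM (cmeasurable_conj mLam) (comb_term_measurable _ _ _).
exists r, (fun k => (S (k, r k)).1.1), (fun k => (S (k, r k)).1.2), (fun k => (S (k, r k)).2).
split => // k; have := HS (k, r k) (mr k); case: (S (k, r k)) => [[P d] M]; exact.
Qed.

Lemma boundary_problem : exists f, [/\ analytic_on_disc f, f 0 = 0 &
  mostly 0 (fun t => exists l, NTlim f (expi t) l /\
     complex.Re (conjc (Lam t) * l) = phi t)].
Proof.
have [r [P [d [M [r0 HS rS]]]]] := stages_exist.
pose B k := comb_term (P k) (d k) (M k).
have M0 k : (0 < M k)%N by have [] := HS k.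
have [f [af Hf]] : exists f, analytic_on_disc f /\
    forall z, normc z < 1 -> ccvg (fun n => \sum_(0 <= k < n) B k z) (f z).
  apply: analytic_series => k; last by have [] := HS k.
  by move=> s; apply: comb_term_quad_exists.
exists f; split => //.
  have := Hf 0 ltac:(by rewrite normc0).
  move=> H; apply: (ccvg_unique H).
  rewrite (_ : (fun n => _) = fun=> 0); first exact: ccvg_cst.
  apply/funext => n; rewrite big1 // => k _.
  by rewrite /B /comb_term expr0n eqn0Ngt M0 mulr0 mul0r.
pose N k := (M k + d k)%N.
have N0 k : (0 < N k)%N by rewrite addn_gt0 M0.
have G1 : mostly 0 (fun t => exists K, forall k, (K <= k)%N ->
    normc (Lam t * (r k t)%:C%C - (P k).[expi t] / expi t ^+ d k) <= tol k /\
    gap k <= normc (1 - expi t ^+ N k)).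
  apply: (@mostly_borel_cantelli _ 7) => // k.
  (* One part for the failure of the approximation, six for the comb. *)
  rewrite (_ : 7 * h k = h k + 6 * h k); last by ring.
  apply: mostly_and; first by have [] := HS k.
  apply: comb_mostly => //; rewrite half_pow_gt0 /=.
  by have := half_pow_le1 R k; have := @pi_ge2 R; move: (h k) => *; lra.
have G2 : mostly 0 (fun t : R => forall k, expi t ^+ N k != 1).
  by apply: mostly0_all => k; exact: comb_null.
apply: mostly_imp (mostly0_and G1 G2) => t _ [[K HK] HN] {G1 G2}.
have z1 := @normc_expi R t.
have zd k : normc (expi t ^+ k) = 1 by rewrite normcX z1 expr1n.
have LL : conjc (Lam t) * Lam t = 1.
  have := normc_sqr (Lam t); rewrite Lam1 expr1n; case: (Lam t) => a b /= E.
  by apply/eqP; rewrite eq_complex /=; apply/andP; split; apply/eqP; lra.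
pose T k := (P k).[expi t] / expi t ^+ d k.
pose g k : C := - 2 * expi t ^+ N k / (1 - expi t ^+ N k).
have BT k : B k (expi t) = T k * g k by exact: comb_term_laurent.
have nT k : normc (T k) = normc (P k).[expi t] by rewrite normcM normcV zd invr1 mulr1.
have ng k : (K <= k)%N -> normc (g k) <= 2 / gap k.
  move=> /HK[_ ge]; rewrite !normcM normcV zd mulr1.
  have -> : normc (- 2 : C) = 2.
    by rewrite normc_opp; have := normc_real (2 : R); rewrite rmorph_nat => ->; rewrite ger0_norm.
  rewrite ler_wpM2l // lef_pV2 // posrE ?gap_gt0 // (lt_le_trans (gap_gt0 k)) //.
(* Since [Re g = 1] and [conj Lam * Lam = 1], the old residual is the real part of
   [conj Lam * (Lam * r) * g]. The new one is thus an error of at most [tol k] multiplied by at most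
   [2 / gap k]. *)
have rb k : (K <= k)%N -> `|r k.+1 t| <= 2 * h k * gap k.+1.
  move=> Kk; have [ap ge] := HK k Kk.
  have -> : r k.+1 t = complex.Re (conjc (Lam t) * ((Lam t * (r k t)%:C%C - T k) * g k)).
    rewrite rS -/(B k) BT.
    have -> : conjc (Lam t) * ((Lam t * (r k t)%:C%C - T k) * g k) =
      (conjc (Lam t) * Lam t) * ((r k t)%:C%C * g k) + - (conjc (Lam t) * (T k * g k)) by ring.
    rewrite LL mul1r Re_add; congr (_ + _); last by case: (_ * _).
    have := Re_comb (zd (N k)) (HN k); rewrite -/(g k).
    by case: (g k) => a b /= ->; rewrite mul0r subr0 mulr1.
  apply: (le_trans (Re_le_normc _)); rewrite 2!normcM normc_conj Lam1 mul1r.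
  apply: (le_trans (ler_pM (normc_ge0 _) (normc_ge0 _) ap (ng k Kk))).
  rewrite /tol; have := gap_gt0 k; move: (gap k) => x x0.
  have -> // : h k * (x * gap k.+1) * (2 / x) = 2 * h k * gap k.+1.
  by field; rewrite gt_eqF.
(* The residual comes from the preceding stage, hence the start at [K.+1]: it is at most
   [4 * h k * gap k], and [tol k <= h k * gap k] enters twice. *)
have Pb k : (K.+1 <= k)%N -> (normc (P k).[expi t] + tol k) / gap k <= 6 * h k.
  case: k => // k; rewrite ltnS => Kk.
  have [ap _] := HK k.+1 (leqW Kk).
  have g0 := gap_gt0 k.+1; have g1 := gap_le1 k.+2; have hk := half_pow_gt0 R k.
  have rk := rb k Kk.
  have tk : tol k.+1 <= h k * gap k.+1 / 2.
    rewrite /tol exprS.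
    have : h k * gap k.+1 * gap k.+2 <= h k * gap k.+1.
      by rewrite ler_piMr // mulr_ge0 // ltW.
    move: (h k) (gap k.+1) (gap k.+2) => x y w; lra.
  have Tk : normc (T k.+1) <= `|r k.+1 t| + tol k.+1.
    have -> : T k.+1 = Lam t * (r k.+1 t)%:C%C - (Lam t * (r k.+1 t)%:C%C - T k.+1) by ring.
    apply: (le_trans (ler_normcB _ _)); rewrite normcM Lam1 mul1r normc_real.
    by rewrite lerD2l.
  rewrite ler_pdivrMr // -nT exprS.
  by move: g0 Tk rk tk; move: (gap k.+1) (h k) => x y *; lra.
have Bb k : (K.+1 <= k)%N -> normc (B k (expi t)) <= 12 * h k.
  move=> Kk; rewrite BT normcM nT.
  apply: (le_trans (ler_wpM2l (normc_ge0 _) (ng k (ltnW Kk)))).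
  have := Pb k Kk; rewrite mulrDl.
  have : 0 <= tol k / gap k by rewrite divr_ge0 // ltW // ?tol_gt0 ?gap_gt0.
  by rewrite mulrCA; move: (h k) (tol k / gap k) (_ / gap k) => *; lra.
have [l Hl] := complex_series_half Bb.
exists l; split.
  apply: (@NTlim_series _ B f (expi t) (fun k => B k (expi t)) l) => //.
  - by move=> k; apply: comb_term_NTlim => //; exact: HN.
  - move=> A A1; have [n Hn] := natr_le_exists A.
    (* The constant is [8 A] from [stage] times 6 from [Pb]. The index must pass [n] because stage
       [k] governs only apertures up to [k.+1]. *)
    exists (48 * A), (maxn n K.+1); split; first by rewrite mulr_ge0 //; lra.
    move=> k; rewrite geq_max => /andP[nk Kk] z cz.
    have [_ _ _ Hcone] := HS k; have [_ ge] := HK k (ltnW Kk).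
    have := Hcone A (expi t) z (gap k).
    have -> : 1 <= A <= k.+1%:R by rewrite A1 Hn // leqW.
    have -> : 0 < gap k <= 2 by rewrite gap_gt0 (le_trans (gap_le1 k)) // ler1n.
    move=> /(_ isT z1 cz isT ge) /le_trans; apply.
    have := Pb k Kk; move: (_ / gap k) (h k) => x y xy.
    have : A * x <= A * (6 * y) by rewrite ler_wpM2l //; lra.
    lra.
  - by exists 12, K.+1.
(* The recursion for the residuals telescopes; by [rb] the residual tends to 0, which identifies the
   limit. *)
have E n : complex.Re (conjc (Lam t) * \sum_(0 <= k < n) B k (expi t)) = phi t - r n t.
  elim: n => [|n IH]; first by rewrite big_geq // mulr0 r0 subrr.
  by rewrite big_nat_recr //= mulrDr Re_add IH rS -/(B n); ring.
apply/eqP; rewrite -subr_eq0 -normr_le0; apply/ler_addgt0Pr => e e0; rewrite add0r.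
have e4 : 0 < e / 4 by rewrite divr_gt0.
have [n1 Hn1] := Hl _ e4; have [n2 Hn2] := half_pow_small e4.
pose n := maxn n1 (maxn n2 K).
have L1 : normc (\sum_(0 <= k < n.+1) B k (expi t) - l) <= e / 4.
  by apply: Hn1; rewrite leqW // leq_maxl.
have L2 : `|r n.+1 t| <= 2 * (e / 4).
  have Kn : (K <= n)%N by rewrite /n !leq_max leqnn !orbT.
  have hn : h n <= e / 4 by apply: Hn2; rewrite /n !leq_max leqnn !orbT.
  apply: (le_trans (rb n Kn)).
  have := gap_le1 n.+1; have := gap_gt0 n.+1; have := half_pow_gt0 R n.
  move: (h n) hn (gap n.+1) => x xe y x0 y0 y1.
  have : x * y <= x by rewrite ler_piMr // ltW.
  lra.
have -> : complex.Re (conjc (Lam t) * l) - phi t =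
   - (complex.Re (conjc (Lam t) * (\sum_(0 <= k < n.+1) B k (expi t) - l)) + r n.+1 t).
  by rewrite mulrBr Re_add E; case: (conjc (Lam t) * l) => a b /=; ring.
rewrite normrN; apply: (le_trans (ler_normD _ _)).
have := Re_le_normc (conjc (Lam t) * (\sum_(0 <= k < n.+1) B k (expi t) - l)).
rewrite normcM normc_conj Lam1 mul1r; lra.
Qed.

End Construction.

(** * Infinitely many solutions *)

Section Solutions.
Variable R : realType.
Local Notation C := R[i].

Lemma disc_normc (z : C) : disc z <-> normc z < 1.
Proof. by rewrite /disc /= norm_normc -(rmorph1 (real_complex R)) ltcR. Qed.

Lemma analytic_NTlim0 (f : C -> C) : analytic_on_disc f -> NTlim f 0 (f 0).
Proof.
move=> af A e e0.
have d0 : disc (0 : C) by apply/disc_normc; rewrite normc0.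
have /derivable1_diffP/differentiable_continuous cf := af 0 d0.
move/cvgrPdist_le : cf => /(_ (e%:C)%C); rewrite ltcR => /(_ e0).
move=> /nbhs_ballP[d /= dp Hd].
have dR : d = ((complex.Re d)%:C)%C.
  by move: dp; rewrite ltcE => /andP[/eqP i0 _]; case: d i0 {Hd} => x y /= ->.
exists (complex.Re d); split; first by rewrite dR ltcR in dp.
move=> z _; rewrite subr0 => zd.
have := Hd z; rewrite /ball /= sub0r normrN norm_normc dR ltcR => /(_ zd).
by rewrite norm_normc lecR normcB.
Qed.

Lemma analytic_power_mul (f : C -> C) m : analytic_on_disc f ->
  analytic_on_disc (fun z => z ^+ m * (1 + f z)).
Proof.
move=> af z zd; apply: derivableM.
  by apply: exprn_derivable.
by apply: derivableD; [exact: derivable_cst|exact: af].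
Qed.

Lemma NTlim_ext (f g : C -> C) zeta L : (forall z, f z = g z) -> NTlim f zeta L -> NTlim g zeta L.
Proof. by move=> /funext ->. Qed.

Lemma NTlim_expr0 n : NTlim (fun z : C => z ^+ n) 0 (0 ^+ n).
Proof.
elim: n => [|n IH]; first exact: NTlim_cst.
apply: (@NTlim_ext (fun z => z * z ^+ n)); first by move=> z; rewrite exprS.
rewrite exprS; apply: NTlimM IH => A e e0; exists e; split => // z _.
by rewrite subr0 => /ltW.
Qed.

Lemma NTlim0_eq0 (f : C -> C) L : (forall z, z != 0 -> normc z < 1 -> f z = 0) ->
  NTlim f 0 L -> L = 0.
Proof.
move=> f0 H; apply: eq0_normc; apply/eqP; rewrite -normr_le0 ger0_norm ?normc_ge0 //.
apply/ler_addgt0Pr => e e0; rewrite add0r; have [d [d0 Hd]] := H 1 e e0.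
(* For [x <= 1/2] the real point [x] satisfies [x <= 1 - x], so it lies in the cone of aperture 1 at
   [0]. *)
pose x : R := Num.min (d / 2) (1 / 2).
have x0 : 0 < x by rewrite lt_min !divr_gt0.
have x1 : x <= 1 / 2 by rewrite ge_min lexx orbT.
have xd : x <= d / 2 by rewrite ge_min lexx.
have nx : normc (x%:C)%C = x by rewrite normc_real gtr0_norm.
have := Hd (x%:C)%C; rewrite /cone subr0 nx f0 ?sub0r ?normc_opp //; last 2 first.
- by rewrite -(rmorph0 (real_complex R)) (inj_eq (@complexI R)) gt_eqF.
- by rewrite nx; lra.
by apply; [split; lra|lra].
Qed.

Lemma NTlim_sum_ord n (F : 'I_n -> C -> C) zeta (L : 'I_n -> C) :
  (forall i, NTlim (F i) zeta (L i)) ->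
  NTlim (fun z => \sum_(i < n) F i z) zeta (\sum_(i < n) L i).
Proof.
elim: n F L => [|n IH] F L H.
  rewrite big_ord0; apply: NTlim_ext (NTlim_cst _ _) => z; by rewrite big_ord0.
rewrite big_ord_recl; apply: (NTlim_ext _ (NTlimD (H ord0) (IH _ _ (fun i => H (lift ord0 i))))).
by move=> z; rewrite big_ord_recl.
Qed.

Variables (lam : C -> C) (phi : C -> R).
Hypothesis lam1 : forall zeta : C, `|zeta| = 1 -> `|lam zeta| = 1.
Hypothesis mRe : Lmeasurable_fun (fun t : R => complex.Re (lam (expi t))).
Hypothesis mIm : Lmeasurable_fun (fun t : R => complex.Im (lam (expi t))).
Hypothesis mphi : Lmeasurable_fun (fun t : R => phi (expi t)).

(* The solution is [z^m (1 + g)], where [g] solves the problem for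
   [lam * conj zeta^m] and [phi - Re (conj lam * zeta^m)]. *)
Lemma solution_with_order m : exists g, [/\ analytic_on_disc g, g 0 = 0 &
  S_set lam phi (fun z => z ^+ m * (1 + g z))].
Proof.
pose Lam (t : R) := lam (expi t) * conjc (expi t ^+ m).
pose psi (t : R) := phi (expi t) - complex.Re (conjc (lam (expi t)) * expi t ^+ m).
have mz := @cmeasurable_expi R.
have ml : cmeasurable (fun t : R => lam (expi t)) by [].
have nl (t : R) : normc (lam (expi t)) = 1.
  apply: (@complexI R); rewrite -norm_normc lam1 //.
  by rewrite norm_normc normc_expi.
have L1 t : normc (Lam t) = 1.
  by rewrite normcM nl normc_conj normcX normc_expi expr1n mul1r.
have mL : cmeasurable Lam.
  exact: cmeasurableM ml (cmeasurable_conj (cmeasurableX _ mz)).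
have mp : Lmeasurable_fun psi.
  apply: measurable_funB; first exact: mphi.
  exact: (cmeasurableM (cmeasurable_conj ml) (cmeasurableX m mz)).1.
have [g [ag g0 Hg]] := boundary_problem L1 mL mp.
exists g; split; [exact: ag|exact: g0|split]; first exact: analytic_power_mul.
pose Q (zeta : C) := forall gamma, nontangential_path zeta gamma ->
  (fun s : R => complex.Re (conjc (lam zeta) * (gamma s ^+ m * (1 + g (gamma s)))))
    @ (1 : R)^'- --> phi zeta.
apply: (@ae_periodic R Q); apply: mostly_imp Hg => t _ [l [Hl El]] gamma ng.
have z1 := @normc_expi R t.
have H : NTlim (fun z => z ^+ m * (1 + g z)) (expi t) (expi t ^+ m * (1 + l)).
  by apply: NTlimM (NTlimX _ z1) _; apply: NTlimD (NTlim_cst _ _) Hl.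
have -> : phi (expi t) = complex.Re (conjc (lam (expi t)) * (expi t ^+ m * (1 + l))).
  rewrite mulrDr mulr1 mulrDr Re_add.
  have -> : conjc (lam (expi t)) * (expi t ^+ m * l) = conjc (Lam t) * l.
    rewrite mulrA; congr (_ * l); rewrite /Lam.
    case: (lam _) (_ ^+ m) => a b [a' b']; apply/eqP; rewrite eq_complex /=.
    by apply/andP; split; apply/eqP; ring.
  by rewrite El /psi; ring.
exact: NTlim_path_Re z1 ng H.
Qed.

(** For [i < n] the difference of the solutions of orders [i] and [n] behaves like [z^i] at the
    origin. In a vanishing combination the coefficients are killed in increasing order: divide by
    [z^k] and let [z] tend to 0. *)
Lemma infinite_dim_solutions : infinite_dim_diff_span (S_set lam phi).
Proof.
move=> n; have /choice[g Hg] := solution_with_order.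
pose f m z : C := z ^+ m * (1 + g m z).
exists (fun i : 'I_n => fun z => f i z - f n z); split.
  move=> i; exists 1%N, (fun=> 1), (fun=> f i), (fun=> f n); split.
    by move=> _; split; [have [] := Hg i|have [] := Hg n].
  by move=> z _; rewrite big_ord1 rmorph1 mul1r.
move=> c H0.
suff K k : forall i : 'I_n, (i < k)%N -> c i = 0 by move=> i; exact: (K n).
elim: k => [|k IH] // i; rewrite ltnS leq_eqVlt => /predU1P[ik|]; last exact: IH.
have lim1 m : NTlim (fun z => 1 + g m z) 0 1.
  have [am gm0 _] := Hg m; have := NTlimD (NTlim_cst 0 1) (analytic_NTlim0 am).
  by rewrite gm0 addr0.
(* The [j]-th term of the relation divided by [z^k]. For [j < k] the coefficient is already known to
   vanish, and the truncated subtraction [j - k] would give a wrong power. *)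
pose G (j : 'I_n) z := if (j < k)%N then 0 else
  (c j)%:C%C * (z ^+ (j - k) * (1 + g j z) + -1 * (z ^+ (n - k) * (1 + g n z))).
have kn : (k < n)%N by rewrite -ik.
have HG j : NTlim (G j) 0 (if (j < k)%N then 0 else
    (c j)%:C%C * (0 ^+ (j - k) * 1 + -1 * (0 ^+ (n - k) * 1))).
  rewrite /G; case: ifP => _; first exact: NTlim_cst.
  apply: NTlimM (NTlim_cst _ _) _; apply: NTlimD; first exact: NTlimM (NTlim_expr0 _) (lim1 _).
  by apply: NTlimM (NTlim_cst _ _) _; exact: NTlimM (NTlim_expr0 _) (lim1 _).
have := NTlim0_eq0 _ (NTlim_sum_ord HG).
have pow0 p : (k < p)%N -> (0 : C) ^+ (p - k) = 0.
  by move=> kp; rewrite expr0n subn_eq0 leqNgt kp.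
rewrite (bigD1 i) //= ik ltnn subnn expr0 (pow0 n kn) mul0r mulr0.
rewrite big1 ?addr0 => [|j ji].
  rewrite !mulr1 => /(_ _)-E; apply: (@complexI R); rewrite -[RHS]E {E}//.
  move=> z z0 z1; have zk : z ^+ k != 0 by rewrite expf_neq0.
  apply: (mulfI zk); rewrite mulr0 -[RHS](H0 z); last exact/disc_normc.
  rewrite mulr_sumr; apply: eq_bigr => j _; rewrite /G /f; case: ltnP => [jk|kj].
    by rewrite mulr0 (IH j jk) rmorph0 mul0r.
  have -> : z ^+ j = z ^+ (j - k) * z ^+ k by rewrite -exprD subnK.
  have -> : z ^+ n = z ^+ (n - k) * z ^+ k by rewrite -exprD subnK // ltnW.
  ring.
case: ltnP => // kj; rewrite pow0 ?mul0r ?addr0 ?mulr0 //.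
rewrite ltn_neqAle kj andbT -ik; apply: contra ji => /eqP E.
by apply/eqP/val_inj.
Qed.

End Solutions.

Unset Implicit Arguments.
Set Strict Implicit.

Theorem theorem5p1 (R : realType) (lam : R[i] -> R[i]) (phi : R[i] -> R) :
  (forall zeta : R[i], `|zeta| = 1 -> `|lam zeta| = 1) ->
  Lmeasurable_fun (fun t : R => complex.Re (lam (expi t))) ->
  Lmeasurable_fun (fun t : R => complex.Im (lam (expi t))) ->
  Lmeasurable_fun (fun t : R => phi (expi t)) ->
  infinite_dim_diff_span (S_set lam phi).
Proof. exact: infinite_dim_solutions. Qed.
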